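(* For every $\varepsilon>0$ there is a constant $c(\varepsilon)>0$, depending only on $\varepsilon$, such that the following holds. Let $p$ be a prime, let $\mathcal{H}$ be a multiplicative subgroup of $\mathbb{F}_p^*$ of order $H=|\mathcal{H}|<p^{1/2}$, let $\mathcal{N}=\{L+1,\ldots,L+N\}$ be an interval of $N$ consecutive integers with $1\le N\le p$ ($L$ an integer), and let $a$ be an integer with $\gcd(a,p)=1$. Then $$ \sum_{n\in\mathcal{N}}\left|\sum_{x\in\mathcal{H}}\mathbf{e}_p(anx)\right|\le c(\varepsilon)\,p^{\varepsilon}\,NH\cdot\min\{\Delta_1^{1/4},\Delta_2^{1/6}\}, $$ where $$ \Delta_1=\frac{p}{NH^{2+11/20}}\,\Gamma(\mathcal{N},\mathcal{H}),\qquad \Delta_2=\frac{p}{NH^{3}}\,\Gamma(\mathcal{N},\mathcal{H}), $$ and $$ \Gamma(\mathcal{N},\mathcal{H})=1+\frac{H}{N}+\frac{NH}{p}+\frac{H^{3/4}}{p^{1/4}}. $$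
   Context: $\mathbb{F}_p$ is the field with $p$ elements, with elements represented by $\{0,1,\ldots,p-1\}$, and $\mathbf{e}_p(z)=\exp(2\pi i z/p)$. The paper writes the bound with $\lesssim$, where $A\lesssim B$ means that for any $\varepsilon>0$ there is a constant $c(\varepsilon)$ depending only on $\varepsilon$ with $|A|\le c(\varepsilon)Bp^{\varepsilon}$; this is expanded in the claim. *)

(* Defs.v *)
From HB Require Import structures.
From mathcomp Require Export all_boot all_order all_algebra all_fingroup.
From mathcomp Require Export all_classical all_reals all_analysis.
From mathcomp Require Export complex.

Set Implicit Arguments.
Unset Strict Implicit.
Unset Printing Implicit Defensive.

Import Order.TTheory GRing.Theory Num.Theory.

Local Open Scope ring_scope.
Local Open Scope complex_scope.

(* exp (x + i y) = e^x (cos y + i sin y) *)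
Definition cexp (R : realType) (z : R[i]) : R[i] :=
  (expR (complex.Re z))%:C * (cos (complex.Im z) +i* sin (complex.Im z)).

Definition ep (R : realType) (p : nat) (z : int) : R[i] :=
  cexp (2 * (pi : R)%:C * 'i%C * z%:~R / p%:R).

Definition int_interval (L : int) (N : nat) : seq int :=
  [seq L + i%:Z | i <- iota 1 N].

(* An element of 'F_p is stored as its representative in {0, ..., p - 1},
   so [val] of the underlying field element is that integer. The modulus is
   taken in R because the library's norm on R[i] is R[i]-valued. *)
Definition subgroup_sum (R : realType) (p : nat) (H : {group {unit 'F_p}})
    (b : int) : R :=
  Normc.normc (\sum_(x in H) ep R p (b * (val (FinRing.uval x))%:Z)).

(* N and H are the cardinalities of the interval and of the subgroup. *)
Definition Gamma (R : realType) (p N H : nat) : R :=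
  1 + H%:R / N%:R + N%:R * H%:R / p%:R + H%:R `^ (3 / 4) / p%:R `^ (1 / 4).

Definition Delta1 (R : realType) (p N H : nat) : R :=
  p%:R / (N%:R * H%:R `^ (2 + 11 / 20)) * Gamma R p N H.

Definition Delta2 (R : realType) (p N H : nat) : R :=
  p%:R / (N%:R * H%:R ^+ 3) * Gamma R p N H.

(* Main.v *)
Require Import Defs.
From mathcomp Require Import fintype finset cyclic zify ring lra.

Set Implicit Arguments.
Unset Strict Implicit.
Unset Printing Implicit Defensive.

Import Order.TTheory GRing.Theory Num.Theory.

Local Open Scope ring_scope.

(* Write G for the subgroup, n for its order and A(u) for |sum_(x in G) e_p(u x)|.
   Since A is G-invariant, n times the sum to be bounded is
   sum_u J(u) A(u), where J(u) counts the ways to write u as a * m * x with m in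
   the interval and x in G. By Hoelder's inequality this is controlled by
   sum J, by sum J^2, and by the fourth or the sixth moment of A, which are p
   times the additive energies E = #{x1 + x2 = y1 + y2} and
   T = #{x1 + x2 + x3 = y1 + y2 + y3} of G.

   Energies: Stepanov's method bounds, for a set of pairs th, the number of t
   with (t^n, (t - 1)^n) in the set, hence (up to a logarithm) the sum of the
   cubes of these fibre sizes by n^2. Restricting both sides of an energy
   equation to equal products of the variables loses only a factor n, by
   Cauchy--Schwarz, and turns the count into one of triangles with vertices in
   G, which these fibres control: T << n^(4 + o(1)) and E^9 << n^(22 + o(1));
   note 22/9 < 49/20.

   Collisions: sum J^2 counts m x = m' x', that is, points of the lattices
   {(x, y) : x = h y mod p}, h in G, whose differences must be counted in a box.
   This reduces to the sum over h of the inverse lengths of the shortest vectors.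
   Products of short vectors for h and h' are short vectors for h h', so the
   divisor bound makes short vectors rare and yields the factor Gamma. *)

(** * Stepanov's method *)

(** The exponents in the two Deltas come from the moments. Let S be the sum to be bounded, with sum
    J^2 << n N Gamma. The fourth moment gives S^4 << (N n)^4 p Gamma E / (N n^5), the sixth S^6 <<
    (N n)^6 p Gamma T / (N n^7). So E << n^(49/20) leaves n^(2 + 11/20), and T << n^4 leaves n^3.
    Triangles appear because, when a1 + a2 + a3 = b1 + b2 + b3 and the products agree, the path 1,
    b1/a1, b1 b2/(a1 a2), 1 closes (its last step multiplies by b3/a3), and each a_i - b_i is an
    element of G times one of its sides. Only the n-th powers of the sides matter then, and ratios
    of sides have the form t, t - 1; this is why Stepanov's method is applied to the pairs (t^n, (t
    - 1)^n). The assumption n^2 < p keeps the sparse factors of Stepanov's polynomial of degree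
    below p. Beyond that, independence would break down: X^p - 1 = (X - 1)^p has two monomials and a
    zero of order p. *)

Lemma nontrivial_solution (F : fieldType) (I J : finType) (c : I -> J -> F) :
  (#|J| < #|I|)%N ->
  exists2 lam : I -> F, (exists i, lam i != 0) &
    forall j, \sum_i lam i * c i j = 0.
Proof.
move=> ltJI.
pose M := \matrix_(i < #|I|, j < #|J|) c (enum_val i) (enum_val j).
have kn0 : kermx M != 0.
  rewrite -mxrank_eq0 mxrank_ker -lt0n subn_gt0.
  exact: leq_ltn_trans (rank_leq_col M) ltJI.
have [k rk] : exists k, row k (kermx M) != 0.
  apply/existsP; apply: contraNT kn0; rewrite negb_exists => /forallP h.
  by apply/eqP/row_matrixP => i; apply/eqP; rewrite row0; have := h i; rewrite negbK.
have vM : row k (kermx M) *m M = 0 by apply/sub_kermxP; exact: row_sub.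
move: (row k _) rk vM => v rk vM.
exists (fun i => v 0 (enum_rank i)).
  apply/existsP; apply: contraNT rk; rewrite negb_exists => /forallP h.
  apply/eqP/rowP => i; have := h (enum_val i); rewrite negbK enum_valK => /eqP.
  by rewrite !mxE.
move=> j; have := congr1 (fun B : 'rV_(#|J|) => B 0 (enum_rank j)) vM.
rewrite !mxE => h; rewrite -[RHS]h {h}.
rewrite (reindex (fun i : 'I_#|I| => enum_val i)) /=; last first.
  by exists enum_rank => x _; rewrite ?enum_valK ?enum_rankK.
by apply: eq_bigr => i _; rewrite !mxE enum_valK enum_rankK.
Qed.

Definition nb_monomials (F : fieldType) (q : {poly F}) : nat :=
  count (fun c => c != 0) q.

Lemma nb_monomials_sum (F : fieldType) (q : {poly F}) m :
  (size q <= m)%N -> nb_monomials q = (\sum_(i < m) ((q`_i != 0)%R : nat))%N.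
Proof.
move=> le; rewrite /nb_monomials -sum1_count big_mkcond /=.
rewrite (big_nth 0) big_mkord (big_ord_widen_cond m (fun _ => true) (fun i => if q`_i != 0 then 1%N else 0%N)) //.
rewrite big_mkcond /=; apply: eq_bigr => i _.
case: ltnP => /= h; last by rewrite nth_default ?eqxx.
by case: eqP.
Qed.

Lemma nb_monomials_deriv (F : fieldType) (q : {poly F}) :
  q`_0 != 0 -> (nb_monomials q^`() < nb_monomials q)%N.
Proof.
move=> q0.
have sz : (0 < size q)%N by case: (posnP (size q)) q0 => // h; rewrite nth_default ?h ?eqxx.
have sz' : (size q^`() <= (size q).-1)%N by apply/leq_sizeP => j hj; rewrite coef_deriv nth_default ?mul0rn //; case: (size q) hj.
rewrite (nb_monomials_sum sz') (@nb_monomials_sum _ q (size q).-1.+1); last by rewrite prednK.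
rewrite big_ord_recl /= q0 add1n ltnS; apply: leq_sum => i _.
rewrite coef_deriv /bump leq0n add1n; case: (q`_i.+1 =P 0) => [->|_]; first by rewrite mul0rn eqxx.
by case: (_ != 0).
Qed.

Lemma nb_monomials_mulX (F : fieldType) (q : {poly F}) v :
  nb_monomials ('X^v * q) = nb_monomials q.
Proof.
have le : (size ('X^v * q)%R <= v + size q)%N.
  by apply: leq_trans (size_polyMleq _ _) _; rewrite size_polyXn.
rewrite (nb_monomials_sum le) (nb_monomials_sum (leqnn _)) big_split_ord /=.
rewrite big1 ?add0n => [|i _]; last by rewrite coefXnM ltn_ord eqxx.
by apply: eq_bigr => i _; rewrite coefXnM ltnNge leq_addr addnC addnK.
Qed.

Lemma poly_strip_X (F : fieldType) (q : {poly F}) :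
  q != 0 -> exists v, exists2 r : {poly F}, q = 'X^v * r & r`_0 != 0.
Proof.
elim: (size q) {-2}q (leqnn (size q)) => [|m IH] {}q szq q0.
  by move: szq; rewrite leqn0 size_poly_eq0 (negPf q0).
have [q00|] := eqVneq q`_0 0; last by exists 0%N, q; rewrite ?expr0 ?mul1r.
have dvd : 'X %| q by rewrite -['X]subr0 -polyC0 dvdp_XsubCl /root horner_coef0 q00.
have [r qE] : exists r, q = r * 'X by exists (q %/ 'X); rewrite divpK.
have r0 : r != 0 by apply: contraNneq q0 => r0; rewrite qE r0 mul0r.
have [|v [r' rE r'0]] := IH r _ r0.
  by move: szq; rewrite qE size_mulX.
by exists v.+1, r' => //; rewrite qE rE exprSr mulrAC.
Qed.

(* A polynomial of degree less than the characteristic with at most s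
   monomials vanishes at 1 to order less than s: strip the power of X and
   differentiate. *)
Lemma sparse_poly_eq0 (F : fieldType) p (s : nat) (q : {poly F}) :
  p \in [pchar F] -> (size q <= p)%N ->
  (nb_monomials q <= s)%N -> ('X - 1%:P) ^+ s %| q -> q = 0.
Proof.
move=> pF; have pp := pcharf_prime pF.
elim: s q => [|s IH] q szq.
  rewrite leqn0 => /eqP h _; apply/eqP; apply/negPn/negP => q0.
  have : has (fun c => c != 0) q.
    by apply/hasP; exists (lead_coef q); rewrite ?lead_coef_eq0 // /lead_coef mem_nth // ltn_predL lt0n size_poly_eq0.
  by rewrite has_count -/(nb_monomials q) h.
move=> hs dv; apply/eqP/negPn/negP => q0.
have [v [r qE r0]] := poly_strip_X q0.
have szr : (size r <= p)%N.
  apply: leq_trans szq; rewrite qE mulrC size_mulXn ?leq_addl //.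
  by apply: contraNneq q0 => r1; rewrite qE r1 mulr0.
have cop : coprimep (('X - 1%:P) ^+ s.+1) ('X^v : {poly F}).
  apply: coprimep_expl; apply: coprimep_expr; rewrite coprimep_sym coprimep_XsubC /root.
  by rewrite hornerX oner_eq0.
move: dv; rewrite qE Gauss_dvdpr // => dv.
have dr : r^`() = 0.
  apply: IH.
  - apply: leq_trans szr; apply/leq_sizeP => j hj.
    by rewrite coef_deriv nth_default ?mul0rn // leqW.
  - rewrite -ltnS; apply: leq_trans (nb_monomials_deriv r0) _.
    by rewrite -(nb_monomials_mulX r v) -qE.
  - case/dvdpP: dv => g ->; rewrite derivM deriv_exp derivXsubC mul1r /=.
    apply: dvdp_add; first by rewrite exprS mulrA dvdp_mull.
    by rewrite -mulr_natl mulrA dvdp_mull.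
(* Since the degree is below the characteristic, a zero derivative makes [r] a nonzero constant,
   which a positive power of X - 1 cannot divide. *)
have rC : r = (r`_0)%:P.
  apply/polyP => -[|i]; rewrite coefC //=.
  have [ip|pi] := ltnP i.+1 p; last by rewrite nth_default // (leq_trans szr).
  have := congr1 (fun q : {poly F} => q`_i) dr; rewrite coef_deriv coef0 -mulr_natr => /eqP.
  rewrite mulf_eq0 => /orP[/eqP //|]; rewrite -(dvdn_pcharf pF) => /dvdn_leq.
  by move=> /(_ isT); rewrite leqNgt ip.
have := dvdp_leq _ dv; rewrite size_exp_XsubC rC size_polyC r0 polyC_eq0 r0 => /(_ isT).
by [].
Qed.

Lemma nb_monomialsD (F : fieldType) (q r : {poly F}) :
  (nb_monomials (q + r) <= nb_monomials q + nb_monomials r)%N.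
Proof.
pose m := maxn (size q) (size r).
rewrite (@nb_monomials_sum _ _ m) ?size_polyD //.
rewrite (@nb_monomials_sum _ q m) ?leq_maxl // (@nb_monomials_sum _ r m) ?leq_maxr //.
rewrite -big_split /=; apply: leq_sum => i _; rewrite coefD.
have [->|_] := eqVneq q`_i 0; first by rewrite add0r.
by case: (_ == 0).
Qed.

Lemma nb_monomials_lincomb (F : fieldType) (I : finType) (c : I -> F)
    (e : I -> nat) :
  (nb_monomials (\sum_i c i *: 'X^(e i)) <= #|I|)%N.
Proof.
have one a m : (nb_monomials (a *: 'X^m : {poly F}) <= 1)%N.
  rewrite -mul_polyC mulrC nb_monomials_mulX /nb_monomials polyseqC.
  by case: (a != 0) => //=; rewrite addn0 leq_b1.
rewrite cardE -sum1_size /index_enum -enumT.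
elim: (enum I) => [|i s IH]; rewrite ?big_nil ?big_cons.
  by rewrite /nb_monomials polyseq0.
by apply: leq_trans (nb_monomialsD _ _) _; exact: leq_add.
Qed.

(** The factor X (X - 1) makes this derivation map X^m (X - 1)^k f to a product with the same first
    two factors. [twisted m k] is its action on the cofactor f, and raises the degree by at most
    one. *)
Definition delta (F : fieldType) (q : {poly F}) := 'X * ('X - 1%:P) * q^`().

Definition twisted (F : fieldType) (m k : nat) (f : {poly F}) :=
  'X * ('X - 1%:P) * f^`() + (('X - 1%:P) *+ m + 'X *+ k) * f.

Lemma delta_sum (F : fieldType) (I : finType) (c : I -> F) (q : I -> {poly F}) d :
  iter d (@delta F) (\sum_i c i *: q i) = \sum_i c i *: iter d (@delta F) (q i).
Proof.
elim: d => [//|d IH]; rewrite iterS IH /delta raddf_sum mulr_sumr.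
by apply: eq_bigr => i _; rewrite /= derivZ scalerAr.
Qed.

Lemma deriv_XsubCn (F : fieldType) (t : F) k :
  ('X - t%:P) * (('X - t%:P) ^+ k)^`() = ('X - t%:P) ^+ k *+ k.
Proof.
case: k => [|k]; first by rewrite expr0 derivC mulr0 mulr0n.
by rewrite deriv_exp derivXsubC mul1r /= mulrnAr -exprS.
Qed.

Lemma delta_twisted (F : fieldType) m k (f : {poly F}) :
  delta ('X^m * ('X - 1%:P) ^+ k * f) =
  'X^m * ('X - 1%:P) ^+ k * twisted m k f.
Proof.
rewrite /delta /twisted !derivM.
have h1 : 'X * ('X^m)^`() = 'X^m *+ m :> {poly F}.
  by have := deriv_XsubCn (0 : F) m; rewrite subr0.
have h2 := deriv_XsubCn (1 : F) k.
set Y := 'X - 1%:P in h2 *; set Xm := 'X^m in h1 *; set Yk := Y ^+ k in h2 *.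
transitivity (('X * Xm^`()) * (Y * Yk * f) + 'X * Xm * (Y * Yk^`()) * f
  + 'X * Y * Xm * Yk * f^`()); first by ring.
by rewrite h1 h2 -[Xm *+ m]mulr_natl -[Yk *+ k]mulr_natl -[Y *+ m]mulr_natl -['X *+ k]mulr_natl; ring.
Qed.

Lemma iter_delta_twisted (F : fieldType) m k (f : {poly F}) d :
  iter d (@delta F) ('X^m * ('X - 1%:P) ^+ k * f) =
  'X^m * ('X - 1%:P) ^+ k * iter d (twisted m k) f.
Proof. by elim: d => [//|d IH]; rewrite iterS IH delta_twisted. Qed.

Lemma size_iter_twisted (F : fieldType) m k (f : {poly F}) d s :
  (size f <= s)%N -> (size (iter d (twisted m k) f) <= s + d)%N.
Proof.
move=> sf; elim: d => [|d IH]; first by rewrite addn0.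
rewrite iterS addnS; move: (iter _ _ _) IH => g; move: (s + d)%N => r sg.
apply: leq_trans (size_polyD _ _) _; rewrite geq_max; apply/andP; split.
  have [->|g0] := eqVneq g 0; first by rewrite derivC mulr0 size_poly0.
  apply: leq_trans (size_polyMleq _ _) _.
  have := @size_polyMleq F 'X ('X - 1%:P); rewrite size_polyX size_XsubC /=.
  have := lt_size_deriv g0.
  move: (size _) (size _) (size g) sg => /=; lia.
apply: leq_trans (size_polyMleq _ _) _.
have : (size (('X - 1%:P) *+ m + 'X *+ k : {poly F})%R <= 2)%N.
  apply: leq_trans (size_polyD _ _) _; rewrite geq_max -!scaler_nat.
  apply/andP; split; apply: leq_trans (size_scale_leq _ _) _ => //.
    by rewrite size_XsubC.
  by rewrite size_polyX.
move: (size _) (size g) sg; lia.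
Qed.

Lemma natr_fact_neq0 (F : fieldType) p k :
  p \in [pchar F] -> (k < p)%N -> (k`!%:R : F) != 0.
Proof.
move=> pF; elim: k => [|k IH] kp; first exact: oner_neq0.
rewrite factS natrM mulf_neq0 ?IH 1?ltnW // -(dvdn_pcharf pF).
by apply/negP => /(dvdn_leq (ltn0Sn k)); rewrite leqNgt kp.
Qed.

(* On (X - t)^k * g the k-th iterate of delta takes the value
   k! (t (t - 1))^k g(t) at t. *)
Lemma dvdp_XsubC_delta (F : fieldType) p (t : F) (D : nat) (q : {poly F}) :
  p \in [pchar F] -> (D <= p)%N -> t != 0 -> t != 1 ->
  (forall j, (j < D)%N -> (iter j (@delta F) q).[t] = 0) ->
  ('X - t%:P) ^+ D %| q.
Proof.
move=> pF Dp t0 t1 van.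
have [->|q0] := eqVneq q 0; first exact: dvdp0.
have [k [g]] := multiplicity_XsubC q t; rewrite q0 /= => gt qE.
have [Dk|kD] := leqP D k.
  by rewrite qE; apply: dvdp_mull; exact: dvdp_exp2l.
have key j : (j <= k)%N -> exists2 h : {poly F},
    iter j (@delta F) q = h * ('X - t%:P) ^+ (k - j) &
    h.[t] = (k ^_ j)%:R * (t * (t - 1)) ^+ j * g.[t].
  elim: j => [_|j IH jk].
    by exists g; rewrite ?subn0 // ffactn0 expr0 !mul1r.
  have [h hE ht] := IH (ltnW jk).
  exists ('X * ('X - 1%:P) * (h^`() * ('X - t%:P) + h *+ (k - j))).
    rewrite iterS hE /delta derivM.
    have kj : (k - j = (k - j.+1).+1)%N by rewrite -subSn // subSS.
    by rewrite kj deriv_exp derivXsubC mul1r /= exprS -[h *+ _]mulr_natl -[_ ^+ _ *+ _]mulr_natl; ring.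
  rewrite !hornerE hornerMn ht subrr mulr0 add0r ffactnSr natrM exprS -[_ *+ (k - j)]mulr_natl.
  by ring.
have [h hE ht] := key k (leqnn k).
have := van k kD; rewrite hE subnn expr0 mulr1 ht ffactnn => /eqP.
rewrite !mulf_eq0 -rootE (negPf gt) orbF expf_eq0 mulf_eq0 (negPf t0) subr_eq0 (negPf t1) andbF orbF.
by rewrite (negPf (natr_fact_neq0 pF (leq_trans kD Dp))).
Qed.

Lemma dvdp_prod_XsubC (F : fieldType) (s : seq F) (A : nat) (q : {poly F}) :
  uniq s -> (forall t, t \in s -> ('X - t%:P) ^+ A %| q) ->
  \prod_(t <- s) ('X - t%:P) ^+ A %| q.
Proof.
elim: s => [_ _|t s IH /= /andP[ts us] h]; first by rewrite big_nil dvd1p.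
rewrite big_cons Gauss_dvdp; last first.
  apply: coprimep_expl; rewrite coprimep_sym coprimep_XsubC rootE horner_prod.
  rewrite prodf_seq_neq0; apply/allP => u us' /=.
  rewrite horner_exp expf_neq0 // hornerXsubC subr_eq0.
  by apply: contraNneq ts => ->.
rewrite h ?mem_head //=; apply: IH => // u us'; apply: h.
by rewrite inE us' orbT.
Qed.

(* Comparing orders of vanishing at 1 separates the powers of (X - 1)^n. *)
Lemma stepanov_independence (F : fieldType) p n A B
    (lam : 'I_A * 'I_B * 'I_B -> F) :
  p \in [pchar F] -> (0 < A)%N -> (A * B <= n)%N -> (A + n * B <= p)%N ->
  \sum_i lam i *: ('X^(n * i.1.2) * ('X - 1%:P) ^+ (n * i.2) * 'X^(i.1.1)) = 0 ->
  forall i, lam i = 0.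
Proof.
move=> pF A0 ABn ABp Psi0.
pose P (c : 'I_B) := \sum_(ab : 'I_A * 'I_B) lam (ab, c) *: ('X^(ab.1 + n * ab.2) : {poly F}).
have PsiE : \sum_(c < B) ('X - 1%:P) ^+ (n * c) * P c = 0.
  rewrite -[RHS]Psi0.
  transitivity (\sum_(ab : 'I_A * 'I_B) \sum_(c < B) lam (ab, c) *: ('X^(n * ab.2) * ('X - 1%:P) ^+ (n * c) * 'X^(ab.1))); last first.
    by rewrite pair_bigA; apply: eq_bigr => -[ab c].
  rewrite exchange_big /=; apply: eq_bigr => c _; rewrite mulr_sumr.
  by apply: eq_bigr => ab _; rewrite exprD -scalerAr; congr (_ *: _); ring.
have szP c : (size (P c) <= p)%N.
  apply: leq_trans (size_sum _ _ _) _; apply/bigmax_leqP => -[a b] _.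
  apply: leq_trans (size_scale_leq _ _) _; rewrite size_polyXn.
  apply: leq_trans ABp; rewrite -addSn leq_add // leq_mul2l [(b <= B)%N]ltnW ?orbT //.
(* Induction on c: once the lower terms vanish, the remaining ones carry (X - 1)^(n (c + 1)), so P c
   is divisible by (X - 1)^n while having at most A B <= n monomials. *)
have P0 m : forall c : 'I_B, (c < m)%N -> P c = 0.
  elim: m => [//|m IH] c; rewrite ltnS leq_eqVlt => /orP[/eqP cm|/IH //].
  apply: (@sparse_poly_eq0 _ p (A * B)) => //.
    by apply: leq_trans (nb_monomials_lincomb _ _) _; rewrite card_prod !card_ord.
  apply: dvdp_trans (dvdp_exp2l _ ABn) _.
  move: PsiE; rewrite (bigD1 c) //= => /eqP; rewrite addr_eq0 => /eqP e.
  have nz : ('X - 1%:P : {poly F}) ^+ (n * c) != 0 by rewrite expf_neq0 // polyXsubC_eq0.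
  rewrite -(dvdp_mul2l _ _ nz) e -exprD dvdpNr.
  apply: (big_ind (fun q => _ %| q)); [exact: dvdp0|by move=> x y; exact: dvdp_add|].
  move=> c' cc'; have [c'm|mc'] := ltnP c' m; first by rewrite IH // mulr0 dvdp0.
  apply: dvdp_mulr; apply: dvdp_exp2l; rewrite -mulnSr leq_mul2l.
  apply/orP; right; rewrite ltn_neqAle cm mc' andbT -cm eq_sym.
  by apply: contra cc' => /eqP ecc; apply/eqP/val_inj.
(* A B <= n yields A <= n only if 'I_B is inhabited, hence the argument b. It makes the exponents a
   + n b pairwise distinct, so that the coefficients can be read off. *)
have An a : (a < A)%N -> forall b : 'I_B, (a < n)%N.
  move=> aA b; apply: leq_trans aA _; apply: leq_trans ABn.
  by rewrite -[X in (X <= _)%N]muln1 leq_mul2l (leq_ltn_trans _ (ltn_ord b)) ?orbT.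
move=> [[a b] c]; have := congr1 (fun q : {poly F} => q`_(a + n * b)) (P0 B c (ltn_ord c)).
rewrite coef0 coef_sum (bigD1 (a, b)) //= big1 ?addr0 => [|[a' b'] /= ne].
  by rewrite coefZ coefXn eqxx mulr1.
rewrite coefZ coefXn; case: eqP => [e|]; last by rewrite mulr0.
have n0 : (0 < n)%N by apply: leq_ltn_trans (An a (ltn_ord a) b).
have ea : a = a' :> nat.
  have := congr1 (fun x => x %% n)%N e; rewrite /=.
  have mE x y : ((x + n * y) %% n = x %% n)%N by rewrite addnC mulnC modnMDl.
  by rewrite !mE !modn_small ?(An _ (ltn_ord _) b).
case/eqP: ne; congr pair; apply: val_inj => //=.
by move: e; rewrite ea => /addnI /eqP; rewrite eqn_mul2l eqn0Ngt n0 => /eqP.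
Qed.

(** The points 0 and 1 are left out because [delta] degenerates there and no longer detects the
    order of vanishing. *)
Definition shifted_fiber (F : finFieldType) (n : nat) (Th : {set F * F}) : {set F} :=
  [set t | [&& t != 0, t != 1 & (t ^+ n, (t - 1) ^+ n) \in Th]].

(** The auxiliary polynomial has A B^2 free coefficients. At a point t of the set, t^n and (t - 1)^n
    can be replaced by the entries of a pair in [Th], so that its d-th iterate under [delta] becomes
    a polynomial in t of size at most 2 A. Making all coefficients of it vanish, for every pair and
    every d < A, costs 2 A^2 |Th| equations, fewer than the unknowns. Each point is then a zero of
    order A, and the degree bounds their number. *)
Lemma stepanov_bound (F : finFieldType) p n (Th : {set F * F}) A B :
  p \in [pchar F] -> (0 < A)%N -> (A * B <= n)%N -> (A + n * B <= p)%N ->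
  (2 * #|Th| * A < B * B)%N ->
  (A * #|shifted_fiber n Th| <= A + 2 * (n * B))%N.
Proof.
move=> pF A0 ABn ABp hAB.
have B0 : (0 < B)%N by case: B hAB {ABn ABp} => //; rewrite muln0.
pose I := ('I_A * 'I_B * 'I_B)%type.
pose J := ('I_#|Th| * 'I_A * 'I_(2 * A))%type.
pose tw (i : I) d : {poly F} := iter d (twisted (n * i.1.2) (n * i.2)) 'X^(i.1.1).
pose c (i : I) (j : J) : F := let th := enum_val j.1.1 in
  th.1 ^+ i.1.2 * th.2 ^+ i.2 * (tw i j.1.2)`_j.2.
have ltJI : (#|{: J}| < #|{: I}|)%N.
  rewrite !card_prod !card_ord.
  have -> : (#|Th| * A * (2 * A) = A * (2 * #|Th| * A))%N by ring.
  by rewrite -[X in (_ < X)%N]mulnA ltn_pmul2l.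
have [lam [i0 lam0] hlam] := nontrivial_solution c ltJI.
pose base (i : I) : {poly F} := 'X^(n * i.1.2) * ('X - 1%:P) ^+ (n * i.2) * 'X^(i.1.1).
pose Psi := \sum_i lam i *: base i.
have Psi0 : Psi != 0.
  apply/eqP => /(stepanov_independence pF A0 ABn ABp) h.
  by move: lam0; rewrite h eqxx.
have Ap : (A <= p)%N by apply: leq_trans ABp; exact: leq_addr.
have van t : t \in shifted_fiber n Th -> ('X - t%:P) ^+ A %| Psi.
  rewrite inE => /and3P[t0 t1 tTh].
  apply: (dvdp_XsubC_delta pF Ap t0 t1) => d dA.
  rewrite delta_sum horner_sum.
  transitivity (\sum_(e < 2 * A) (\sum_i lam i * c i (enum_rank_in tTh (t ^+ n, (t - 1) ^+ n), Ordinal dA, e)) * t ^+ e); last first.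
    by apply: big1 => e _; rewrite hlam mul0r.
  under [RHS]eq_bigr => e _ do rewrite mulr_suml.
  rewrite exchange_big /=; apply: eq_bigr => i _.
  rewrite iter_delta_twisted hornerZ !hornerM hornerXn horner_exp hornerXsubC.
  rewrite (@horner_coef_wide _ (2 * A)); last first.
    apply: leq_trans (size_iter_twisted _ _ _ (leqnn _)) _.
    rewrite size_polyXn mul2n -addnn leq_add //.
    exact: ltnW.
  rewrite !mulr_sumr; apply: eq_bigr => e _.
  by rewrite /c enum_rankK_in //= -!exprM /tw; ring.
have szPsi : (size Psi <= A + 2 * (n * B))%N.
  apply: leq_trans (size_sum _ _ _) _; apply/bigmax_leqP => -[[a b] c'] _ /=.
  apply: leq_trans (size_scale_leq _ _) _; rewrite /base /=.
  apply: leq_trans (size_polyMleq _ _) _; rewrite size_polyXn.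
  have := @size_polyMleq F 'X^(n * b) (('X - 1%:P) ^+ (n * c')).
  rewrite size_polyXn size_exp_XsubC /=.
  have hb : (n * b <= n * B)%N by rewrite leq_mul2l [(b <= B)%N]ltnW ?orbT.
  have hc : (n * c' <= n * B)%N by rewrite leq_mul2l [(c' <= B)%N]ltnW ?orbT.
  have := ltn_ord a; move: hb hc; move: (size _) => s; lia.
have dv : \prod_(t <- enum (shifted_fiber n Th)) ('X - t%:P) ^+ A %| Psi.
  by apply: dvdp_prod_XsubC (enum_uniq _) _ => t; rewrite mem_enum; exact: van.
have := dvdp_leq Psi0 dv.
have -> : \prod_(t <- enum (shifted_fiber n Th)) ('X - t%:P) ^+ A
   = (\prod_(t <- enum (shifted_fiber n Th)) ('X - t%:P)) ^+ A by rewrite prodrXl.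
move=> /leq_trans /(_ szPsi).
have := size_exp (\prod_(t <- enum (shifted_fiber n Th)) ('X - t%:P)) A.
rewrite size_prod_XsubC /= -cardE mulnC => <- h.
by apply: leq_trans h; exact: leq_pred.
Qed.

(** * Third moment of the fibre sizes *)

Definition fiber (F : finFieldType) (n : nat) (th : F * F) : nat :=
  #|shifted_fiber n [set th]|.

Lemma sum_fiber (F : finFieldType) n (Th : {set F * F}) :
  (\sum_(th in Th) fiber n th)%N = #|shifted_fiber n Th|.
Proof.
rewrite -sum1_card (partition_big (fun t => (t ^+ n, (t - 1) ^+ n)) (mem Th)) /=; last first.
  by move=> t; rewrite inE => /and3P[].
apply: eq_bigr => th thTh; rewrite /fiber -sum1_card; apply: eq_bigl => t.
rewrite !inE; have [->|_] := eqVneq (t ^+ n, (t - 1) ^+ n) th; last by rewrite !andbF.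
by rewrite thTh !andbT.
Qed.

Lemma card_nth_root (F : finFieldType) n (a : F) :
  (0 < n)%N -> (#|[set t : F | t ^+ n == a]| <= n)%N.
Proof.
move=> n0; have nz : 'X^n - a%:P != 0 :> {poly F}.
  by rewrite -size_poly_eq0 size_XnsubC.
have := @max_poly_roots _ _ (enum [set t : F | t ^+ n == a]) nz.
rewrite size_XnsubC // -cardE ltnS; apply; last exact: enum_uniq.
apply/allP => t; rewrite mem_enum inE rootE hornerD hornerXn hornerN hornerC.
by rewrite subr_eq0.
Qed.

Lemma fiber_le (F : finFieldType) n (th : F * F) :
  (0 < n)%N -> (fiber n th <= n)%N.
Proof.
move=> n0; apply: leq_trans (card_nth_root th.1 n0).
apply: subset_leq_card; apply/subsetP => t; rewrite !inE => /and3P[_ _].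
by case: th => a b /eqP[-> _].
Qed.

Lemma subset_of_card (T : finType) (S : {set T}) h :
  (h <= #|S|)%N -> exists2 S' : {set T}, S' \subset S & #|S'| = h.
Proof.
move=> hS; exists [set x in take h (enum S)].
  by apply/subsetP => x; rewrite inE => /mem_take; rewrite mem_enum.
rewrite cardsE (card_uniqP _) ?take_uniq ?enum_uniq // size_takel //.
by rewrite -cardE.
Qed.

(** With h = |Th|, b is about (2 h n)^(1/3) and a about n / b, which makes a b <= n and 2 h a < b^2
    nearly tight. Then h k <= 5 b^2 and b^3 <= 16 h n give (h k)^3 <= 5^3 16^2 h^2 n^2. The
    assumption 16 h <= n^2 ensures b <= n, so that a is positive. *)
Lemma fiber_level_small (F : finFieldType) p n (Th : {set F * F}) k :
  p \in [pchar F] -> (n * n < p)%N -> (0 < #|Th|)%N -> (16 * #|Th| <= n * n)%N ->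
  (forall th, th \in Th -> (k <= fiber n th)%N) ->
  (#|Th| * k ^ 3 <= 125 * 256 * (n * n))%N.
Proof.
move=> pF np h0 hn hk; set h := #|Th| in h0 hn *.
have n4 : (4 <= n)%N.
  by rewrite leqNgt; apply/negP => n4; have := leq_mul n4 n4; rewrite leqNgt; nia.
have ex : exists b, (2 * h * n < b ^ 3)%N.
  exists (2 * h * n).+1; apply: leq_trans (_ : (2 * h * n).+1 ^ 1 <= _)%N; first by rewrite expn1.
  by rewrite leq_pexp2l.
case: (ex_minnP ex) => b hb bmin.
have b2 : (2 <= b)%N.
  case: b hb {bmin} => [|[|//]]; rewrite ?exp0n ?exp1n //; nia.
have hb' : ((b.-1) ^ 3 <= 2 * h * n)%N.
  by rewrite leqNgt; apply/negP => /bmin; lia.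
have bn : (2 * b.-1 <= n)%N.
  rewrite -(@leq_exp2r _ _ 3) // expnMn; apply: leq_trans (leq_mul (leqnn _) hb') _.
  have -> : (n ^ 3 = n * n * n)%N by rewrite !expnS expn0; ring.
  by apply: leq_trans (_ : 16 * h * n <= _)%N; [nia|rewrite leq_mul2r hn orbT].
set a := (n %/ b)%N.
have a0 : (0 < a)%N by rewrite divn_gt0; lia.
have ab : (a * b <= n)%N by exact: leq_trunc_div.
have nab : (n < 2 * (a * b))%N.
  have := ltn_ceil n (ltnW b2); rewrite -/a; nia.
have fb : (h * k <= #|shifted_fiber n Th|)%N.
  rewrite -sum_fiber -sum_nat_const; exact: leq_sum.
have := @stepanov_bound F p n Th a b pF a0 ab.
rewrite -/h => /(_ _ _)/(leq_trans (leq_mul (leqnn a) fb)).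
have h1 : (a + n * b <= p)%N.
  apply: ltnW; apply: leq_ltn_trans np; nia.
have h2 : (2 * h * a < b * b)%N.
  have bb : (b * b * b = b ^ 3)%N by rewrite !expnS expn0; ring.
  have : (2 * h * a * b < b * b * b)%N.
    rewrite bb; apply: leq_ltn_trans hb; rewrite -!mulnA -2?mulnA; nia.
  by rewrite ltn_mul2r => /andP[].
move=> /(_ h1 h2) key.
have hk5 : (h * k <= 5 * (b * b))%N.
  have e1 : (n * b <= 2 * (a * b) * b)%N by rewrite leq_mul2r ltnW ?orbT.
  have e2 : (a <= a * (b * b))%N by rewrite leq_pmulr // muln_gt0 (ltnW b2).
  have : (a * (h * k) <= a * (5 * (b * b)))%N.
    apply: leq_trans key _; move: e1 e2; rewrite !mulnA; lia.
  by rewrite leq_pmul2l.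
have b3 : (b ^ 3 <= 16 * (h * n))%N.
  have : (b ^ 3 <= (2 * b.-1) ^ 3)%N by rewrite leq_exp2r //; lia.
  by rewrite expnMn; move: hb'; lia.
have : ((h * k) ^ 3 <= 125 * 256 * (h ^ 2 * (n * n)))%N.
  apply: leq_trans (_ : (5 * (b * b)) ^ 3 <= _)%N; first by rewrite leq_exp2r.
  have -> : ((5 * (b * b)) ^ 3 = 125 * (b ^ 3 * b ^ 3))%N by rewrite !expnS !expn0; ring.
  have -> : (125 * 256 * (h ^ 2 * (n * n)) = 125 * ((16 * (h * n)) * (16 * (h * n))))%N.
    by rewrite !expnS !expn0; ring.
  by rewrite leq_mul2l leq_mul.
rewrite expnMn (_ : h ^ 3 = h ^ 2 * h)%N; last by rewrite -expnSr.
rewrite [X in (_ <= X)%N]mulnCA -mulnA leq_pmul2l ?expn_gt0 ?h0 //.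
Qed.

(* The exponent 3 is the one that the Szemeredi--Trotter bound would give. *)
Lemma fiber_level : exists C : nat, forall (F : finFieldType) p n (Th : {set F * F}) k,
  p \in [pchar F] -> (n * n < p)%N -> (#|Th| <= n * n)%N ->
  (forall th, th \in Th -> (k <= fiber n th)%N) ->
  (#|Th| * k ^ 3 <= C * (n * n))%N.
Proof.
exists (32 * (125 * 256) + 27)%N => F p n Th k pF np hT hk.
move: (125 * 256)%N (@fiber_level_small F p n) => K hsmall.
have [T0|T0] := posnP #|Th|; first by rewrite T0.
have n0 : (0 < n)%N by move: T0 hT; case: n {np hk hsmall} => //; lia.
have [n4|n4] := ltnP n 4.
  have [th thT] : exists th, th \in Th by apply/set0Pn; rewrite -card_gt0.
  have k3 : (k ^ 3 <= 27)%N.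
    have -> : (27 = 3 ^ 3)%N by [].
    rewrite leq_exp2r //; apply: leq_trans (hk th thT) _.
    by apply: leq_trans (fiber_le _ n0) _.
  apply: leq_trans (leq_mul hT k3) _; rewrite [X in (X <= _)%N]mulnC leq_mul2r.
  by rewrite leq_addl orbT.
have [le|lt] := leqP (16 * #|Th|) (n * n).
  apply: leq_trans (hsmall Th k pF np T0 le hk) _; rewrite leq_mul2r; lia.
have h16 : (16 <= n * n)%N by apply: (leq_mul n4 n4).
(* Too large a set is replaced by a subset of n^2 / 16 elements, rounded down. As n >= 4 this is at
   least n^2 / 32, so the loss is a factor 32. *)
have [|S ST Sh] := @subset_of_card _ Th (n * n %/ 16)%N.
  by rewrite -(@leq_pmul2l 16) // mulnC; apply: leq_trans (leq_trunc_div _ _) (ltnW lt).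
have s0 : (0 < #|S|)%N by rewrite Sh divn_gt0.
have := hsmall S k pF np s0; rewrite {1}Sh mulnC leq_trunc_div => /(_ isT).
have hkS th : th \in S -> (k <= fiber n th)%N by move=> /(subsetP ST); exact: hk.
move=> /(_ hkS) hS.
have nS : (n * n <= 32 * #|S|)%N.
  rewrite Sh; have := ltn_ceil (n * n) (isT : 0 < 16)%N.
  have : (0 < n * n %/ 16)%N by rewrite -Sh.
  lia.
apply: leq_trans (_ : (32 * #|S|) * k ^ 3 <= _)%N.
  by rewrite leq_mul2r (leq_trans hT nS) orbT.
by rewrite -mulnA; apply: leq_trans (leq_mul (leqnn 32) hS) _; rewrite mulnA leq_mul2r leq_addr orbT.
Qed.

(** Dyadic decomposition by fibre size: each level contributes O(n^2) by [fiber_level], and no fibre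
    exceeds n, which bounds the number of levels. *)
Lemma sum_fiber_cube : exists C : nat, forall (F : finFieldType) p n (Th : {set F * F}),
  p \in [pchar F] -> (n * n < p)%N -> (#|Th| <= n * n)%N ->
  (\sum_(th in Th) fiber n th ^ 3 <= C * (n * n) * (trunc_log 2 n).+1)%N.
Proof.
have [C hC] := fiber_level; exists (8 * C)%N => F p n Th pF np hT.
have [n00|n0] := posnP n.
  by move: hT; rewrite n00 leqn0 cards_eq0 => /eqP ->; rewrite big_set0.
pose lev (th : F * F) : 'I_(trunc_log 2 n).+1 := inord (trunc_log 2 (fiber n th)).
rewrite (partition_big lev xpredT) //=.
apply: leq_trans (_ : \sum_(j < (trunc_log 2 n).+1) 8 * C * (n * n) <= _)%N; last first.
  by rewrite sum_nat_const card_ord mulnC.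
apply: leq_sum => j _.
pose S := [set th in Th | (lev th == j) && (0 < fiber n th)%N].
have levE th : (0 < fiber n th)%N -> lev th = trunc_log 2 (fiber n th) :> nat.
  by move=> f0; rewrite inordK // ltnS; apply: leq_trunc_log; exact: fiber_le.
have St th : th \in S -> (2 ^ j <= fiber n th < 2 ^ j.+1)%N.
  rewrite inE => /and3P[_ /eqP <- f0]; rewrite levE //.
  exact: trunc_log_bounds.
apply: leq_trans (_ : \sum_(th in S) (2 ^ j.+1) ^ 3 <= _)%N.
  (* [trunc_log 2 0 = 0] puts the empty fibres on level 0, where the lower bound 2^j fails for them;
     they contribute nothing and are split off. *)
  rewrite (bigID (fun th => (0 < fiber n th)%N)) /= [X in (_ + X)%N]big1 ?addn0; last first.
    by move=> th /andP[_]; rewrite -eqn0Ngt => /eqP ->.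
  rewrite (eq_bigl (fun th => th \in S)) => [|th]; last by rewrite inE andbA.
  by apply: leq_sum => th /St /andP[_ lt]; rewrite leq_exp2r // ltnW.
rewrite sum_nat_const [(2 ^ j.+1)%N]expnS expnMn mulnCA -[X in (_ <= X)%N]mulnA.
rewrite (_ : 8 = 2 ^ 3)%N // leq_mul2l; apply/orP; right.
apply: (hC _ p) => //.
  apply: leq_trans hT; apply: subset_leq_card.
  by apply/subsetP => th; rewrite inE => /andP[].
by move=> th /St /andP[].
Qed.

(** * Additive energies of a subgroup *)

(** The form x^2 <= y z avoids square roots, so it also serves for integers. After doubling, the
    terms compare one by one: 2 x_i x_j <= y_i z_j + y_j z_i, by the inequality of the means. *)
Lemma cauchy_schwarz (R : realDomainType) (I : finType) (P : {pred I}) (x y z : I -> R) :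
  (forall i, P i -> 0 <= y i) -> (forall i, P i -> 0 <= z i) ->
  (forall i, P i -> x i ^+ 2 <= y i * z i) ->
  (\sum_(i | P i) x i) ^+ 2 <= (\sum_(i | P i) y i) * (\sum_(i | P i) z i).
Proof.
move=> y0 z0 xyz.
have two : 0 < 2 :> R by rewrite ltr0n.
rewrite -(ler_pM2l two) expr2.
have -> : 2 * ((\sum_(i | P i) y i) * (\sum_(i | P i) z i)) =
  \sum_(i | P i) \sum_(j | P j) (y i * z j + y j * z i).
  rewrite mulr_suml; under [RHS]eq_bigr do rewrite big_split /=.
  rewrite big_split /= [X in _ + X]exchange_big /= mulr2n mulrDl mul1r.
  by congr (_ + _); apply: eq_bigr => i _; rewrite mulr_sumr.
rewrite mulr_suml mulr_sumr; apply: ler_sum => i Pi.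
rewrite !mulr_sumr; apply: ler_sum => j Pj.
have yz0 : 0 <= y i * z j + y j * z i.
  by rewrite addr_ge0 // mulr_ge0 // ?y0 ?z0.
apply: le_trans (ler_norm _) _; rewrite -ler_sqr ?nnegrE ?normr_ge0 //.
rewrite real_normK ?num_real //.
have : (x i * x j) ^+ 2 <= (y i * z i) * (y j * z j).
  by rewrite exprMn ler_pM ?sqr_ge0 // xyz.
have := sqr_ge0 (y i * z j - y j * z i); nra.
Qed.

Lemma cauchy_schwarz_nat (I : finType) (P : {pred I}) (x y z : I -> nat) :
  (forall i, P i -> (x i ^ 2 <= y i * z i)%N) ->
  ((\sum_(i | P i) x i) ^ 2 <= (\sum_(i | P i) y i) * (\sum_(i | P i) z i))%N.
Proof.
move=> h; rewrite -(ler_nat int) natrX natrM !natr_sum.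
apply: cauchy_schwarz => i Pi; rewrite ?ler0n //.
by rewrite -natrX -natrM ler_nat h.
Qed.

(** Two Cauchy--Schwarz steps through the intermediate sum of f w^2 replace fractional exponents. *)
Lemma hoelder_nat (I : finType) (P : {pred I}) (f w : I -> nat) :
  ((\sum_(i | P i) f i ^ 2 * w i) ^ 3 <=
   (\sum_(i | P i) f i ^ 3) ^ 2 * (\sum_(i | P i) w i ^ 3))%N.
Proof.
set X := (\sum_(i | P i) f i ^ 2 * w i)%N; set Y := (\sum_(i | P i) f i * w i ^ 2)%N.
set a := (\sum_(i | P i) f i ^ 3)%N; set b := (\sum_(i | P i) w i ^ 3)%N.
have [->|X0] := posnP X; first by rewrite exp0n.
have h1 : (X ^ 2 <= a * Y)%N.
  by apply: cauchy_schwarz_nat => i _; rewrite leq_eqVlt; apply/orP; left; apply/eqP; ring.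
have h2 : (Y ^ 2 <= X * b)%N.
  by apply: cauchy_schwarz_nat => i _; rewrite leq_eqVlt; apply/orP; left; apply/eqP; ring.
rewrite -(leq_pmul2l X0) -expnS.
have -> : (X ^ 4 = (X ^ 2) ^ 2)%N by rewrite -expnM.
apply: leq_trans (_ : (a * Y) ^ 2 <= _)%N; first by rewrite leq_exp2r.
rewrite expnMn [X in (_ <= X)%N]mulnCA leq_mul2l; apply/orP; right.
exact: h2.
Qed.

(** By [collE] this is the second moment of the fibre sizes. Both additive energies and the sum of
    J^2 are instances. *)
Definition coll (I : finType) (K : eqType) (P : {set I}) (f : I -> K) : nat :=
  #|[set ij : I * I | [&& ij.1 \in P, ij.2 \in P & f ij.1 == f ij.2]]|.

Lemma collE (I : finType) (K : finType) (P : {set I}) (f : I -> K) :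
  coll P f = (\sum_k #|[set i in P | f i == k]| ^ 2)%N.
Proof.
rewrite /coll -sum1_card (partition_big (fun ij : I * I => f ij.1) xpredT) //=.
apply: eq_bigr => k _; rewrite -mulnn -cardsX -sum1_card; apply: eq_bigl => -[i j].
rewrite !inE /=; case: (f i =P k) => [->|]; last by rewrite !andbF.
by rewrite [k == _]eq_sym; case: (i \in P); case: (j \in P); rewrite ?andbF ?andbT.
Qed.

(** Cauchy--Schwarz on each fibre of f, which g cuts into at most #|Q| pieces. Taking for g a
    product of variables restricts an energy to equal products. *)
Lemma coll_refine (I : finType) (K : finType) (L : finType) (P : {set I})
    (f : I -> K) (g : I -> L) (Q : {set L}) :
  (forall i, i \in P -> g i \in Q) ->
  (coll P f <= #|Q| * coll P (fun i => (f i, g i)))%N.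
Proof.
move=> PQ; rewrite !collE -(pair_bigA _ (fun k l => #|[set i in P | (f i, g i) == (k, l)]| ^ 2)%N) /=.
rewrite big_distrr /=; apply: leq_sum => k _.
have -> : #|[set i in P | f i == k]| = (\sum_(l in Q) #|[set i in P | (f i, g i) == (k, l)]|)%N.
  rewrite -sum1_card (partition_big g (mem Q)) /=; last by move=> i; rewrite inE => /andP[/PQ].
  apply: eq_bigr => l _; rewrite -sum1_card; apply: eq_bigl => i.
  by rewrite !inE xpair_eqE andbA.
apply: leq_trans (cauchy_schwarz_nat (y := fun=> 1%N) (z := fun l => #|[set i in P | (f i, g i) == (k, l)]| ^ 2)%N _) _.
  by move=> l _; rewrite mul1n.
rewrite sum1_card leq_mul2l; apply/orP; right.
by rewrite [X in (_ <= X)%N](bigID (mem Q)) /= leq_addr.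
Qed.

Lemma coll_setX (I I' : finType) (K K' : eqType) (P : {set I}) (P' : {set I'})
    (f : I -> K) (f' : I' -> K') :
  coll (finset.setX P P') (fun x => (f x.1, f' x.2)) = (coll P f * coll P' f')%N.
Proof.
rewrite /coll -cardsX -!sum1_card.
rewrite (reindex (fun x : (I * I) * (I' * I') => ((x.1.1, x.2.1), (x.1.2, x.2.2)))) /=; last first.
  by exists (fun x : (I * I') * (I * I') => ((x.1.1, x.2.1), (x.1.2, x.2.2))) => -[[? ?] [? ?]].
apply: eq_bigl => -[[i j] [i' j']]; rewrite !inE /= xpair_eqE.
by case: (i \in P); case: (i' \in P'); case: (j \in P); case: (j' \in P'); rewrite ?andbF.
Qed.

Lemma leq_card_inj (I J : finType) (phi : I -> J) (P : {set I}) (Q : {set J}) :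
  {in P, forall i, phi i \in Q} -> {in P &, injective phi} -> (#|P| <= #|Q|)%N.
Proof.
move=> sub inj; rewrite -(card_in_imset inj); apply: subset_leq_card.
by apply/subsetP => _ /imsetP[i iP ->]; exact: sub.
Qed.

Lemma leq_coll_inj (I J : finType) (K : eqType) (P : {set I}) (f : I -> K)
    (phi : I * I -> J) (S : {set J}) :
  {in P &, forall i j, f i = f j -> phi (i, j) \in S} ->
  (forall i j i' j', i \in P -> j \in P -> i' \in P -> j' \in P ->
     f i = f j -> f i' = f j' -> phi (i, j) = phi (i', j') -> (i, j) = (i', j')) ->
  (coll P f <= #|S|)%N.
Proof.
move=> sub inj; apply: (leq_card_inj (phi := phi)) => [[i j]|[i j] [i' j']].
  by rewrite inE => /and3P[iP jP /eqP]; exact: sub.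
rewrite !inE /= => /and3P[iP jP /eqP e] /and3P[i'P j'P /eqP e'].
exact: inj.
Qed.

Lemma card_dependent (I J : finType) (P : {set I}) (Q : I -> {set J}) :
  #|[set x : I * J | (x.1 \in P) && (x.2 \in Q x.1)]| = (\sum_(i in P) #|Q i|)%N.
Proof.
rewrite -sum1_card (partition_big (fun x : I * J => x.1) (mem P)) /=; last first.
  by move=> x; rewrite inE => /andP[].
apply: eq_bigr => i iP; rewrite -sum1_card.
rewrite (reindex_onto (fun j => (i, j)) (fun x : I * J => x.2)) /=; last first.
  by move=> [i' j] /=; rewrite inE /= => /andP[_ /eqP ->].
by apply: eq_bigl => j; rewrite inE /= iP !eqxx !andbT.
Qed.

(** Stands for the subgroup: in a field, a subgroup of order n is the full set of n-th roots of
    unity, so membership becomes an equation. *)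
Definition unity_roots (F : finFieldType) (n : nat) : {set F} :=
  [set x | x ^+ n == 1].

Lemma unity_rootsM (F : finFieldType) n (x y : F) :
  x \in unity_roots F n -> y \in unity_roots F n -> x * y \in unity_roots F n.
Proof. by rewrite !inE exprMn => /eqP -> /eqP ->; rewrite mulr1. Qed.

Lemma unity_rootsV (F : finFieldType) n (x : F) :
  x \in unity_roots F n -> x^-1 \in unity_roots F n.
Proof. by rewrite !inE exprVn => /eqP ->; rewrite invr1. Qed.

Lemma unity_rootsD (F : finFieldType) n (x y : F) :
  x \in unity_roots F n -> y \in unity_roots F n -> x / y \in unity_roots F n.
Proof. by move=> xG yG; rewrite unity_rootsM ?unity_rootsV. Qed.

Lemma unity_roots_neq0 (F : finFieldType) n (x : F) :
  (0 < n)%N -> x \in unity_roots F n -> x != 0.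
Proof.
move=> n0; rewrite inE; apply: contraTneq => ->.
by rewrite expr0n eqn0Ngt n0 /= eq_sym oner_eq0.
Qed.

Definition kappa (F : finFieldType) n (t : F) : F * F := (t ^+ n, (t - 1) ^+ n).

Lemma in_shifted_fiber1 (F : finFieldType) n (t : F) th :
  (t \in shifted_fiber n [set th]) = [&& t != 0, t != 1 & kappa n t == th].
Proof. by rewrite inE in_set1. Qed.

(* Nondegenerate triangles (1, b, c) with vertices in the group, up to scaling. *)
Definition triangles (F : finFieldType) n : {set F * F} :=
  [set x | [&& x.1 \in unity_roots F n, x.2 \in unity_roots F n,
               x.1 != 1, x.2 != 1 & x.1 != x.2]].

(** For the triangle (1, b, c), subtracting 1 gives (b - c)/(1 - b), again a ratio of sides. So
    [kappa n] of it records the n-th powers of all three sides up to a common factor. *)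
Definition side_ratio (F : finFieldType) (x : F * F) : F := (1 - x.2) / (1 - x.1).

Lemma side_ratioP (F : finFieldType) n (x : F * F) : x \in triangles F n ->
  [/\ 1 - x.1 != 0, 1 - x.2 != 0, side_ratio x != 0, side_ratio x != 1 &
      side_ratio x - 1 = (x.1 - x.2) / (1 - x.1)].
Proof.
rewrite inE => /and5P[_ _ b1 c1 bc].
have b0 : 1 - x.1 != 0 by rewrite subr_eq0 eq_sym.
have c0 : 1 - x.2 != 0 by rewrite subr_eq0 eq_sym.
have e : side_ratio x - 1 = (x.1 - x.2) / (1 - x.1).
  by rewrite /side_ratio; field.
split => //; first by rewrite /side_ratio mulf_neq0 ?invr_eq0.
by rewrite -subr_eq0 e mulf_neq0 ?invr_eq0 // subr_eq0.
Qed.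

(** A triangle (1, b, c) of ratio t provides a second point s = t b / c of the same fibre, because s
    - 1 = (t - 1) / c. From t and s one recovers c, then b. *)
Lemma card_triangles_fiber (F : finFieldType) n (th : F * F) : (0 < n)%N ->
  (#|[set x in triangles F n | kappa n (side_ratio x) == th]| <= fiber n th ^ 2)%N.
Proof.
move=> n0; rewrite -mulnn /fiber -cardsX.
pose phi (x : F * F) := (side_ratio x, side_ratio x * x.1 / x.2).
apply: (leq_card_inj (phi := phi)) => [x|].
  rewrite [x \in _]inE => /andP[xT /eqP xth].
  have [b0 c0 t0 t1 e] := side_ratioP xT.
  have := xT; rewrite inE => /and5P[bG cG _ _ bc].
  have cn0 := unity_roots_neq0 n0 cG; have bn0 := unity_roots_neq0 n0 bG.
  rewrite inE !in_shifted_fiber1 t0 t1 xth eqxx /=.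
  have e' : side_ratio x * x.1 / x.2 - 1 = (side_ratio x - 1) / x.2.
    by rewrite e /side_ratio; field; rewrite b0 cn0.
  apply/and3P; split.
  - by rewrite !mulf_neq0 ?invr_eq0.
  - by rewrite -subr_eq0 e' mulf_neq0 ?invr_eq0 ?subr_eq0.
  - rewrite /kappa e' -xth /kappa !exprMn !exprVn.
    by move: bG cG; rewrite !inE => /eqP -> /eqP ->; rewrite invr1 !mulr1.
move=> x y; rewrite [x \in _]inE => /andP[xT _]; rewrite [y \in _]inE => /andP[yT _].
have [b0 c0 t0 t1 e] := side_ratioP xT; have [b0' c0' t0' t1' e'] := side_ratioP yT.
have := xT; rewrite inE => /and5P[bG cG _ _ bc].
have := yT; rewrite inE => /and5P[bG' cG' _ _ bc'].
have cn0 := unity_roots_neq0 n0 cG; have cn0' := unity_roots_neq0 n0 cG'.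
have ex : side_ratio x * x.1 / x.2 - 1 = (side_ratio x - 1) / x.2.
  by rewrite e /side_ratio; field; rewrite b0 cn0.
have ey : side_ratio y * y.1 / y.2 - 1 = (side_ratio y - 1) / y.2.
  by rewrite e' /side_ratio; field; rewrite b0' cn0'.
case=> h1 h2; have h3 : (side_ratio x - 1) / x.2 = (side_ratio x - 1) / y.2.
  by rewrite -ex {2}h1 -ey h2.
have h4 : x.2 = y.2.
  by apply: invr_inj; apply: (mulfI _ h3); rewrite subr_eq0.
have h5 : x.1 = y.1.
  move: h2; rewrite -h1 -h4 => /(mulIf _); rewrite invr_eq0 => /(_ cn0).
  by move=> /(mulfI t0).
by case: x y h4 h5 {xT yT b0 c0 t0 t1 e b0' c0' t0' t1' e' bG cG bc bG' cG' bc' cn0 cn0' ex ey h1 h2 h3} => [? ?] [? ?] /= -> ->.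
Qed.

Lemma sum_triangles (F : finFieldType) n (h : F * F -> nat) : (0 < n)%N ->
  (\sum_(x in triangles F n) h (kappa n (side_ratio x)) <=
   \sum_(th in [set kappa n (side_ratio x) | x in triangles F n]) fiber n th ^ 2 * h th)%N.
Proof.
move=> n0; set Th := [set _ | _ in _].
rewrite (partition_big (fun x => kappa n (side_ratio x)) (mem Th)) /=; last first.
  by move=> x xT; apply: imset_f.
apply: leq_sum => th _.
rewrite (eq_bigr (fun=> h th)) => [|x /andP[_ /eqP -> //]].
rewrite sum_nat_const leq_mul2r; apply/orP; right.
apply: leq_trans (card_triangles_fiber th n0); apply: subset_leq_card.
by apply/subsetP => x; rewrite inE.
Qed.

Lemma card_triangle_classes (F : finFieldType) n (f : F * F -> F * F) :
  #|unity_roots F n| = n -> (#|[set f x | x in triangles F n]| <= n * n)%N.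
Proof.
move=> hG; apply: leq_trans (leq_imset_card _ _) _.
rewrite -{2 3}hG -cardsX; apply: subset_leq_card; apply/subsetP => x.
by rewrite !inE => /and5P[-> ->].
Qed.

(* 1 - b, b - c, c - 1 are the sides of the triangle (1, b, c). *)
Definition closing_pairs (F : finFieldType) n (x : F * F) : {set F * F} :=
  [set y | [&& y.1 \in unity_roots F n, y.2 \in unity_roots F n &
    (1 - x.1) + y.1 * (x.1 - x.2) + y.2 * (x.2 - 1) == 0]].

(** Divided by 1 - b, the closing equation for (u, v) reads v t - 1 = u (t - 1), with t the side
    ratio. So v t lies in the fibre of t, and it determines v and u. *)
Lemma card_closing_pairs (F : finFieldType) n (x : F * F) : (0 < n)%N ->
  x \in triangles F n ->
  (#|closing_pairs n x| <= fiber n (kappa n (side_ratio x)))%N.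
Proof.
move=> n0 xT; have [b0 c0 t0 t1 e] := side_ratioP xT.
pose phi (y : F * F) := y.2 * side_ratio x.
have key y : y \in closing_pairs n x ->
    phi y - 1 = y.1 * (side_ratio x - 1).
  rewrite inE => /and3P[_ _ /eqP h]; rewrite /phi e /side_ratio.
  have h' : y.1 * (x.1 - x.2) = y.2 * (1 - x.2) - (1 - x.1).
    by apply/eqP; rewrite -subr_eq0 -h; apply/eqP; ring.
  by rewrite [y.1 * (_ / _)]mulrA h'; field.
apply: (leq_card_inj (phi := phi)) => [y yC|].
  have := yC; rewrite inE => /and3P[uG vG _].
  rewrite in_shifted_fiber1 /kappa (key y yC).
  apply/and3P; split.
  - by rewrite mulf_neq0 // (unity_roots_neq0 n0 vG).
  - by rewrite -subr_eq0 (key y yC) mulf_neq0 ?subr_eq0 // (unity_roots_neq0 n0 uG).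
  - by rewrite /phi !exprMn; move: uG vG; rewrite !inE => /eqP -> /eqP ->; rewrite !mul1r.
move=> y z yC zC h; have := congr1 (fun s => s - 1) h.
rewrite (key y yC) (key z zC) => /(mulIf _) e1; move: h => /(mulIf t0) e2.
have {}e1 : y.1 = z.1 by apply: e1; rewrite subr_eq0.
by case: y z e1 e2 {yC zC} => [? ?] [? ?] /= -> ->.
Qed.

Lemma card_closing_pairs_le (F : finFieldType) n (x : F * F) :
  #|unity_roots F n| = n -> x != (1, 1) -> (#|closing_pairs n x| <= n)%N.
Proof.
move=> hG x1; have [e|ne] := eqVneq (x.2 - 1) 0.
  have b0 : x.1 - x.2 != 0.
    move: e => /eqP; rewrite !subr_eq0 => /eqP e2; rewrite e2.
    by apply: contraNneq x1 => e1; case: x e1 e2 => ? ? /= -> ->.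
  rewrite -{2}hG; apply: (leq_card_inj (phi := snd)) => [y|y z].
    by rewrite inE => /and3P[].
  rewrite !inE => /and3P[_ _ /eqP hy] /and3P[_ _ /eqP hz] e2.
  have e1 : y.1 = z.1.
    apply: (mulIf b0); apply/eqP; rewrite -subr_eq0; apply/eqP.
    by rewrite -[RHS](subrr 0) -{1}hy -hz e2; ring.
  by case: y z e1 e2 {hy hz} => [? ?] [? ?] /= -> ->.
rewrite -{2}hG; apply: (leq_card_inj (phi := fst)) => [y|y z].
  by rewrite inE => /and3P[].
rewrite !inE => /and3P[_ _ /eqP hy] /and3P[_ _ /eqP hz] e2.
have e1 : y.2 = z.2.
  apply: (mulIf ne); apply/eqP; rewrite -subr_eq0; apply/eqP.
  by rewrite -[RHS](subrr 0) -{1}hy -hz e2; ring.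
by case: y z e1 e2 {hy hz} => [? ?] [? ?] /= -> ->.
Qed.

Definition degenerate (F : finFieldType) n : {set F * F} :=
  [set x | [&& x.1 \in unity_roots F n, x.2 \in unity_roots F n &
               [|| x.1 == 1, x.2 == 1 | x.1 == x.2]]].

Lemma sum_square_split (F : finFieldType) n (h : F * F -> nat) :
  (\sum_(x in finset.setX (unity_roots F n) (unity_roots F n)) h x =
   \sum_(x in degenerate F n) h x + \sum_(x in triangles F n) h x)%N.
Proof.
rewrite (bigID (mem (degenerate F n))) /=; congr (_ + _)%N; apply: eq_bigl => x.
  by rewrite !inE; case: (x.1 ^+ n == 1) => //; case: (x.2 ^+ n == 1).
rewrite !inE; case: (x.1 ^+ n == 1) => //; case: (x.2 ^+ n == 1) => //=.
by rewrite !negb_or.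
Qed.

Lemma sum_degenerate (F : finFieldType) n (h : F * F -> nat) :
  (\sum_(x in degenerate F n) h x <= h (1%R, 1%R) +
    \sum_(g in unity_roots F n | g != 1%R) (h (1%R, g) + h (g, 1%R) + h (g, g)))%N.
Proof.
rewrite (bigD1 (1, 1)) ?inE /= ?expr1n ?eqxx // leq_add2l !big_split /=.
have part (P : {set F * F}) (i : F -> F * F) (j : F * F -> F) :
    (forall x, x \in P -> i (j x) = x) ->
    (forall x, x \in P -> (j x \in unity_roots F n) && (j x != 1)) ->
  (\sum_(x in P) h x <= \sum_(g in unity_roots F n | g != 1%R) h (i g))%N.
  move=> ij jP; rewrite (eq_bigr (fun x => h (i (j x)))) => [|x xP]; last by rewrite ij.
  rewrite (partition_big j (fun g => (g \in unity_roots F n) && (g != 1))) //=.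
  apply: leq_sum => g _; rewrite (eq_bigr (fun=> h (i g))) => [|x /andP[_ /eqP -> //]].
  rewrite sum_nat_const -{2}[h _]mul1n leq_mul2r; apply/orP; right.
  apply/card_le1_eqP => x y; rewrite !unfold_in => /andP[xP /eqP xg] /andP[yP /eqP yg].
  by rewrite -(ij x xP) -(ij y yP) xg yg.
rewrite (bigID (fun x : F * F => x.1 == 1)) /= -addnA leq_add //.
  rewrite (eq_bigl (fun x => x \in [set x in degenerate F n | (x != (1, 1)) && (x.1 == 1)])) => [|x]; last by rewrite [RHS]inE andbA.
  apply: (part _ (fun g => (1, g)) snd) => -[a b]; rewrite !inE /= xpair_eqE => /and3P[].
    by move=> _ _ /eqP ->.
  by move=> /and3P[_ -> _] + /eqP a1; rewrite a1 eqxx.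
rewrite (bigID (fun x : F * F => x.2 == 1)) /= leq_add //.
  rewrite (eq_bigl (fun x => x \in [set x in degenerate F n | [&& x != (1, 1), x.1 != 1 & x.2 == 1]])) => [|x]; last by rewrite [RHS]inE !andbA.
  apply: (part _ (fun g => (g, 1)) fst) => -[a b]; rewrite !inE /= xpair_eqE => /and4P[].
    by move=> _ _ _ /eqP ->.
  by move=> /and3P[-> _ _] _ ->.
rewrite (eq_bigl (fun x => x \in [set x in degenerate F n | [&& x != (1, 1), x.1 != 1 & x.2 != 1]])) => [|x]; last by rewrite [RHS]inE !andbA.
apply: (part _ (fun g => (g, g)) fst) => -[a b]; rewrite !inE /= xpair_eqE => /and4P[].
  by move=> /and3P[_ _ /or3P[->|->|/eqP ->]].
by move=> /and3P[-> _ _] _ ->.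
Qed.

Definition energy2 (F : finFieldType) (G : {set F}) : nat :=
  coll (finset.setX G G) (fun x => x.1 + x.2).

Definition energy3 (F : finFieldType) (G : {set F}) : nat :=
  coll (finset.setX (finset.setX G G) G) (fun x => x.1.1 + x.1.2 + x.2).

Lemma sum_triangles_fiber (F : finFieldType) n M : (0 < n)%N ->
  #|unity_roots F n| = n ->
  (forall Th : {set F * F}, (#|Th| <= n * n)%N -> (\sum_(th in Th) fiber n th ^ 3 <= M)%N) ->
  (\sum_(x in triangles F n) fiber n (kappa n (side_ratio x)) <= M)%N.
Proof.
move=> n0 hG hM; apply: leq_trans (sum_triangles _ n0) _.
apply: leq_trans (hM _ (card_triangle_classes (fun x => kappa n (side_ratio x)) hG)).
by apply: leq_sum => th _; rewrite -expnSr.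
Qed.

Lemma card_dependent_square (F J : finFieldType) n (Q : F * F -> {set F * F}) :
  #|unity_roots F n| = n ->
  #|finset.setX (unity_roots F n) [set x : (F * F) * (F * F) |
     (x.1 \in finset.setX (unity_roots F n) (unity_roots F n)) && (x.2 \in Q x.1)]| =
  (n * \sum_(x in finset.setX (unity_roots F n) (unity_roots F n)) #|Q x|)%N.
Proof. by move=> hG; rewrite cardsX hG card_dependent. Qed.

(* Fixing the product of the summands costs a factor n; what remains counts
   closing pairs of triangles. *)
Lemma energy3_bound (F : finFieldType) n M : (0 < n)%N ->
  #|unity_roots F n| = n -> (n * n <= M)%N ->
  (forall Th : {set F * F}, (#|Th| <= n * n)%N -> (\sum_(th in Th) fiber n th ^ 3 <= M)%N) ->
  (energy3 (unity_roots F n) <= 5 * (n * n) * M)%N.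
Proof.
move=> n0 hG nM hM; set G := unity_roots F n.
have Gn0 x : x \in G -> x != 0 by exact: unity_roots_neq0.
apply: leq_trans (coll_refine (g := fun x : F * F * F => x.1.1 * x.1.2 * x.2) (Q := G) _ _) _.
  move=> [[a b] c]; rewrite !in_setX => /andP[/andP[aG bG] cG] /=.
  by rewrite !unity_rootsM.
rewrite hG; pose S := finset.setX G [set x : (F * F) * (F * F) |
     (x.1 \in finset.setX G G) && (x.2 \in closing_pairs n x.1)].
apply: leq_trans (_ : n * #|S| <= _)%N.
  rewrite leq_mul2l; apply/orP; right.
  (* a1 fixes the scale. Multiplied by a1, the closing equation with multipliers a2/b1 and b3/a1
     becomes (a1 - b1) + (a2 - b2) + (a3 - b3) = 0, where a3 appears as b1 b2 b3/(a1 a2). *)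
  pose phi (ij : (F * F * F) * (F * F * F)) :=
    (ij.1.1.1, ((ij.2.1.1 / ij.1.1.1, (ij.2.1.1 * ij.2.1.2) / (ij.1.1.1 * ij.1.1.2)),
                (ij.1.1.2 / ij.2.1.1, ij.2.2 / ij.1.1.1))).
  apply: (leq_coll_inj (phi := phi)).
    move=> [[a1 a2] a3] [[b1 b2] b3]; rewrite !in_setX /=.
    move=> /andP[/andP[a1G a2G] a3G] /andP[/andP[b1G b2G] b3G] [es ep].
    have a10 := Gn0 _ a1G. have a20 := Gn0 _ a2G. have a30 := Gn0 _ a3G. have b10 := Gn0 _ b1G. have b20 := Gn0 _ b2G. have b30 := Gn0 _ b3G.
    rewrite a1G /= inE /= in_setX /= [X in _ && X]inE /=.
    rewrite !unity_rootsD ?unity_rootsM //=.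
    have h3 : b3 = a1 + a2 + a3 - b1 - b2 by rewrite es; ring.
    have h4 : a1 * a2 * a3 = b1 * b2 * b3 := ep.
    apply/eqP; transitivity ((a1 + a2 - b1 - b2 - b3 + b1 * b2 * b3 / (a1 * a2)) / a1).
      by field; rewrite b10 a10 a20.
    rewrite -h4 [a1 * a2 * a3]mulrC mulfK ?mulf_neq0 // h3.
    have -> : a1 + a2 - b1 - b2 - (a1 + a2 + a3 - b1 - b2) + a3 = 0 by ring.
    by rewrite mul0r.
  move=> [[a1 a2] a3] [[b1 b2] b3] [[c1 c2] c3] [[d1 d2] d3]; rewrite !in_setX /=.
  move=> /andP[/andP[a1G a2G] a3G] /andP[/andP[b1G b2G] b3G].
  move=> /andP[/andP[c1G c2G] c3G] /andP[/andP[d1G d2G] d3G] [es ep] [es' ep'] [].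
  have a10 := Gn0 _ a1G. have a20 := Gn0 _ a2G. have a30 := Gn0 _ a3G. have b10 := Gn0 _ b1G. have b20 := Gn0 _ b2G. have b30 := Gn0 _ b3G.
  have c10 := Gn0 _ c1G. have c20 := Gn0 _ c2G. have c30 := Gn0 _ c3G. have d10 := Gn0 _ d1G. have d20 := Gn0 _ d2G. have d30 := Gn0 _ d3G.
  have iV (z : F) : z != 0 -> z^-1 != 0 by rewrite invr_eq0.
  move=> e1; rewrite -e1 => /(mulIf (iV _ a10)) e2; rewrite -e2.
  move=> + /(mulIf (iV _ b10)) e3; rewrite -e3.
  have m0 : (a1 * a2)^-1 != 0 by rewrite invr_eq0 mulf_neq0.
  move=> /(mulIf m0) /(mulfI b10) e4 /(mulIf (iV _ a10)) e5.
  move: es es'; rewrite -e1 -e2 -e3 -e4 -e5 => <- /addrI <-.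
  by [].
rewrite card_dependent_square // sum_square_split.
have -> : (5 * (n * n) * M = n * (n * (4 * M + M)))%N by ring.
rewrite !leq_mul2l; apply/orP; right; apply/orP; right.
apply: leq_trans (_ : (4 * (n * n) + M) <= _)%N; last by rewrite leq_add2r leq_mul2l nM orbT.
apply: leq_add; last first.
  apply: leq_trans (sum_triangles_fiber n0 hG hM); apply: leq_sum => x; exact: card_closing_pairs.
(* At (1, 1) all n^2 pairs close; at the other degenerate points one multiplier determines the
   other, giving three families with at most n^2 pairs each. *)
apply: leq_trans (sum_degenerate _ _) _.
apply: leq_trans (_ : n * n + n * (n + n + n) <= _)%N; last by rewrite -!mulnDr; lia.
apply: leq_add.
  rewrite -{2 3}hG -cardsX; apply: subset_leq_card; apply/subsetP => -[a b].
  by rewrite in_setX inE => /and3P[-> ->].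
apply: leq_trans (_ : \sum_(g in G) (n + n + n) <= _)%N; last by rewrite sum_nat_const hG.
rewrite [X in (X <= _)%N]big_mkcondr /=; apply: leq_sum => g gG.
case: ifP => // g1.
by rewrite !leq_add // card_closing_pairs_le // xpair_eqE (negPf g1) ?andbF.
Qed.

(** * Differences of group elements and the energy E *)

Definition differences (F : finFieldType) n (d : F) : {set F * F} :=
  [set y | [&& y.1 \in unity_roots F n, y.2 \in unity_roots F n & y.1 - y.2 == d]].

Lemma card_differences_opp (F : finFieldType) n (d : F) :
  #|differences n (- d)| = #|differences n d|.
Proof.
suff le (e : F) : (#|differences n e| <= #|differences n (- e)|)%N.
  by apply/eqP; rewrite eqn_leq le -{2}[d]opprK le.
apply: (leq_card_inj (phi := fun y : F * F => (y.2, y.1))) => [y|[? ?] [? ?] _ _ [-> ->] //].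
by rewrite !inE /= => /and3P[-> -> /eqP <-]; rewrite opprB eqxx.
Qed.

Lemma card_differences0 (F : finFieldType) n :
  #|unity_roots F n| = n -> #|differences n (0 : F)| = n.
Proof.
move=> hG; rewrite -[RHS]hG; apply/eqP; rewrite eqn_leq; apply/andP; split.
  apply: (leq_card_inj (phi := fst)) => [y|[a b] [c d]]; first by rewrite !inE => /and3P[].
  rewrite !inE /= !subr_eq0 => /and3P[_ _ /eqP <-] /and3P[_ _ /eqP <-] -> //.
apply: (leq_card_inj (phi := fun x => (x, x))) => [x|x y _ _ [] //].
by rewrite !inE /= subrr eqxx => ->.
Qed.

(** If y1 - y2 = d with y1, y2 in the group, then t = y1 / d satisfies t^n = (t - 1)^n = 1 / d^n. So
    this bounds the number of representations of d by a function of tau = d^n. Since the inverse of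
    0 is 0, tau = 0 gives the fibre over (0, 0), which is empty for n > 0. *)
Definition rho (F : finFieldType) n (tau : F) : nat := fiber n (tau^-1, tau^-1).

Lemma card_differences_rho (F : finFieldType) n (d : F) : (0 < n)%N -> d != 0 ->
  (#|differences n d| <= rho n (d ^+ n))%N.
Proof.
move=> n0 d0; apply: (leq_card_inj (phi := fun y : F * F => y.1 / d)) => [y|y z].
  rewrite inE => /and3P[gG hG /eqP yd].
  have g0 := unity_roots_neq0 n0 gG; have h0 := unity_roots_neq0 n0 hG.
  have y1 : y.1 = y.2 + d by rewrite -yd; ring.
  have e : y.1 / d - 1 = y.2 / d by rewrite y1; field.
  rewrite in_shifted_fiber1 mulf_neq0 ?invr_eq0 //= -subr_eq0 /kappa e.
  rewrite mulf_neq0 ?invr_eq0 //= !exprMn !exprVn.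
  by move: gG hG; rewrite !inE => /eqP -> /eqP ->; rewrite !mul1r.
rewrite !inE => /and3P[_ _ /eqP yd] /and3P[_ _ /eqP zd] /(mulIf _) e1.
have {}e1 : y.1 = z.1 by apply: e1; rewrite invr_eq0.
have e2 : y.2 = z.2 by apply: oppr_inj; apply: (addrI y.1); rewrite yd {1}e1 zd.
by case: y z e1 e2 {yd zd} => [? ?] [? ?] /= -> ->.
Qed.

Lemma rho0 (F : finFieldType) n : (0 < n)%N -> rho n (0 : F) = 0%N.
Proof.
move=> n0; apply/eqP; rewrite cards_eq0; apply/eqP/setP => t.
rewrite in_shifted_fiber1 inE /kappa xpair_eqE invr0 expf_eq0 n0 /=.
by case: eqP; rewrite ?andbF.
Qed.

(** Confines the support of [rho] to at most n values, so that the fibre bound, which asks for at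
    most n^2 classes, covers the sum over all tau. *)
Lemma rho_gt0 (F : finFieldType) n (tau : F) : (0 < n)%N -> (0 < rho n tau)%N ->
  exists2 g, g \in unity_roots F n :\ 1 & tau = (1 - g) ^+ n.
Proof.
move=> n0 /card_gt0P[t]; rewrite in_shifted_fiber1 => /and3P[t0 t1 /eqP[e1 e2]].
have e3 : 1 - (t - 1) / t = t^-1 by field.
exists ((t - 1) / t); last by rewrite e3 exprVn e1 invrK.
rewrite !inE exprMn exprVn e1 e2 invrK -subr_eq0 -oppr_eq0 opprB e3 invr_eq0 t0 /=.
have tau0 : tau != 0.
  by apply: contraNneq t0 => tau0; move: e1; rewrite tau0 invr0 => /eqP; rewrite expf_eq0 => /andP[].
by rewrite mulVf.
Qed.

Lemma sum_rho_cube (F : finFieldType) n M : (0 < n)%N -> #|unity_roots F n| = n ->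
  (forall Th : {set F * F}, (#|Th| <= n * n)%N -> (\sum_(th in Th) fiber n th ^ 3 <= M)%N) ->
  (\sum_(tau : F) rho n tau ^ 3 <= M)%N.
Proof.
move=> n0 hG hM.
pose Th := [set (tau^-1, tau^-1) | tau in [set tau : F | (0 < rho n tau)%N]].
have inj : injective (fun tau : F => (tau^-1, tau^-1)) by move=> x y [/invr_inj].
have cTh : (#|Th| <= n * n)%N.
  apply: leq_trans (leq_imset_card _ _) _.
  apply: leq_trans (_ : #|[set ((1 - g) ^+ n)%R | g in unity_roots F n :\ 1%R]| <= _)%N.
    apply: subset_leq_card; apply/subsetP => tau; rewrite inE => /(rho_gt0 n0)[g gG ->].
    exact: imset_f.
  apply: leq_trans (leq_imset_card _ _) _; apply: leq_trans (_ : #|unity_roots F n| <= _)%N.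
    by apply: subset_leq_card; exact: subD1set.
  by rewrite hG leq_pmulr.
apply: leq_trans (hM Th cTh).
rewrite big_imset /=; last by move=> x y _ _; exact: inj.
rewrite (bigID (fun tau => (0 < rho n tau)%N)) /= [X in (_ + X)%N]big1 ?addn0; last first.
  by move=> tau; rewrite -eqn0Ngt => /eqP ->.
by apply: eq_leq; apply: eq_bigl => tau; rewrite inE.
Qed.

(** A class th fixes the n-th powers of the sides only up to a common factor: they are tau, th.1 tau
    and th.2 tau. The maximum over tau leaves a function of the class alone, to which Hoelder's
    inequality can be applied. *)
Definition weight (F : finFieldType) n (th : F * F) : nat :=
  \max_(tau : F) (rho n tau * (rho n (th.1 * tau)%R * rho n (th.2 * tau)%R))%N.

(** The cube of the maximum is at most the sum over tau of the cubes. For nonzero tau, dilation by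
    tau permutes F, so the sum over th splits into two copies of the sum of rho^3; tau = 0
    contributes nothing. *)
Lemma sum_weight_cube (F : finFieldType) n M (Th : {set F * F}) :
  (0 < n)%N -> (\sum_(tau : F) rho n tau ^ 3 <= M)%N ->
  (\sum_(th in Th) weight n th ^ 3 <= M ^ 3)%N.
Proof.
move=> n0 hM.
apply: leq_trans (_ : \sum_(th : F * F) \sum_(tau : F) (rho n tau * (rho n (th.1 * tau)%R * rho n (th.2 * tau)%R)) ^ 3 <= _)%N.
  rewrite [X in (_ <= X)%N](bigID (mem Th)) /=; apply: leq_trans (leq_addr _ _).
  apply: leq_sum => th _; rewrite /weight.
  have F0 : (0 < #|F|)%N by apply/card_gt0P; exists 0.
  have [tau ->] := bigop.eq_bigmax (fun tau : F => rho n tau * (rho n (th.1 * tau)%R * rho n (th.2 * tau)%R))%N F0.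
  by rewrite [X in (_ <= X)%N](bigD1 tau) //= leq_addr.
rewrite exchange_big /=.
apply: leq_trans (_ : \sum_(tau : F) rho n tau ^ 3 * (M * M) <= _)%N; last first.
  by rewrite -big_distrl /= expnS -mulnn leq_mul.
apply: leq_sum => tau _; have [->|tau0] := eqVneq tau 0.
  by rewrite big1 // => th _; rewrite rho0.
apply: leq_trans (_ : rho n tau ^ 3 * ((\sum_(a : F) rho n (a * tau)%R ^ 3) * (\sum_(a : F) rho n (a * tau)%R ^ 3)) <= _)%N.
  rewrite big_distrl big_distrr /= -(pair_bigA _ (fun a b => (rho n tau * (rho n (a * tau)%R * rho n (b * tau)%R)) ^ 3)%N) /=.
  apply: leq_sum => a _; rewrite big_distrr big_distrr /=; apply: leq_sum => b _.
  by rewrite !expnMn.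
have e : (\sum_(a : F) rho n (a * tau)%R ^ 3 = \sum_(a : F) rho n a ^ 3)%N.
  by symmetry; rewrite (reindex_inj (mulIf tau0)).
by rewrite e leq_mul2l leq_mul ?orbT.
Qed.

Lemma sum_side_differences (F : finFieldType) n M : (0 < n)%N ->
  #|unity_roots F n| = n -> (n * n <= M)%N ->
  (forall Th : {set F * F}, (#|Th| <= n * n)%N -> (\sum_(th in Th) fiber n th ^ 3 <= M)%N) ->
  ((\sum_(x in triangles F n) #|differences n (1 - x.1)%R| *
     (#|differences n (x.1 - x.2)%R| * #|differences n (x.2 - 1)%R|)) ^ 3 <= M ^ 5)%N.
Proof.
move=> n0 hG nM hM.
set Th := [set kappa n (side_ratio x) | x in triangles F n].
apply: leq_trans (_ : (\sum_(th in Th) fiber n th ^ 2 * weight n th) ^ 3 <= _)%N.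
  rewrite leq_exp2r //; apply: leq_trans (sum_triangles _ n0).
  apply: leq_sum => x xT; have [b0 c0 t0 t1 e] := side_ratioP xT.
  have bc0 : x.1 - x.2 != 0 by move: xT; rewrite inE subr_eq0 => /and5P[].
  apply: leq_trans (leq_bigmax ((1 - x.1) ^+ n)) => /=.
  have e2 : #|differences n (x.2 - 1)| = #|differences n (1 - x.2)|.
    by rewrite -card_differences_opp opprB.
  rewrite -!exprMn e /side_ratio !mulfVK // e2 [X in (_ <= _ * X)%N]mulnC.
  by rewrite !leq_mul // card_differences_rho.
apply: leq_trans (hoelder_nat _ _ _) _.
rewrite -[5%N]/(2 + 3)%N expnD leq_mul //.
  by rewrite leq_exp2r // hM // card_triangle_classes.
by apply: sum_weight_cube => //; exact: sum_rho_cube.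
Qed.

(* Fixing the product of three of the summands in E^3 costs a factor n; what
   remains is a sum over triangles of the numbers of representations of the
   sides as differences. *)
Lemma energy2_bound (F : finFieldType) n M : (0 < n)%N ->
  #|unity_roots F n| = n -> (n * n <= M)%N ->
  (forall Th : {set F * F}, (#|Th| <= n * n)%N -> (\sum_(th in Th) fiber n th ^ 3 <= M)%N) ->
  (energy2 (unity_roots F n) ^ 9 <= 512 * n ^ 12 * M ^ 5)%N.
Proof.
move=> n0 hG nM hM; set G := unity_roots F n.
have Gn0 x : x \in G -> x != 0 by exact: unity_roots_neq0.
set X := (\sum_(x in triangles F n) #|differences n (1 - x.1)%R| *
     (#|differences n (x.1 - x.2)%R| * #|differences n (x.2 - 1)%R|))%N.
have hX : (X ^ 3 <= M ^ 5)%N by exact: sum_side_differences.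
pose sides (x : F * F) := finset.setX (differences n (1 - x.1))
   (finset.setX (differences n (x.1 - x.2)) (differences n (x.2 - 1))).
have hW : (\sum_(x in finset.setX G G) #|sides x| <= 4 * (n * M) + X)%N.
  rewrite sum_square_split; apply: leq_add; last first.
    by apply: leq_sum => x _; rewrite !cardsX.
  apply: leq_trans (sum_degenerate _ _) _.
  (* At a degenerate point other than (1, 1) one side is 0, with n representations, and the other
     two agree up to sign, so n times this sum of squares occurs three times. Through g -> 1 / (1 -
     g) each class receives at most [fiber] many g, which turns the squares into cubes. *)
  have hQ : (\sum_(g in G | g != 1%R) #|differences n (1 - g)%R| ^ 2 <= M)%N.
    apply: leq_trans (_ : \sum_(g in G | g != 1%R) rho n ((1 - g) ^+ n)%R ^ 2 <= _)%N.
      apply: leq_sum => g /andP[_ g1]; rewrite leq_exp2r //.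
      by apply: card_differences_rho; rewrite // subr_eq0 eq_sym.
    pose tt (g : F) := (1 - g)^-1.
    have kt g : g \in G -> g != 1 -> kappa n (tt g) = (((1 - g) ^+ n)^-1, ((1 - g) ^+ n)^-1).
      move=> gG g1; have g0 : 1 - g != 0 by rewrite subr_eq0 eq_sym.
      have -> : kappa n (tt g) = ((tt g) ^+ n, (g / (1 - g)) ^+ n).
        by rewrite /kappa /tt; congr (_, _ ^+ n); field.
      rewrite /tt exprMn exprVn; move: gG; rewrite inE => /eqP ->.
      by rewrite mul1r.
    rewrite (eq_bigr (fun g => fiber n (kappa n (tt g)) ^ 2)%N); last first.
      by move=> g /andP[gG g1]; rewrite kt.
    rewrite (partition_big (fun g => kappa n (tt g)) (mem [set kappa n (tt g) | g in G :\ 1])) /=; last first.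
      by move=> g gG; apply: imset_f; rewrite !inE andbC; move: gG; rewrite inE.
    apply: leq_trans (_ : \sum_(th in [set kappa n (tt g) | g in G :\ 1%R]) fiber n th ^ 3 <= _)%N; last first.
      apply: hM; apply: leq_trans (leq_imset_card _ _) _; apply: leq_trans (_ : #|G| <= _)%N.
        by apply: subset_leq_card; exact: subD1set.
      by rewrite hG leq_pmulr.
    apply: leq_sum => th _; rewrite (eq_bigr (fun=> fiber n th ^ 2)%N) => [|g /andP[_ /eqP -> //]].
    rewrite sum_nat_const expnS leq_mul2r; apply/orP; right.
    apply: leq_trans (_ : #|[set g in G | ((g != 1) && (kappa n (tt g) == th))%R]| <= _)%N.
      by apply: eq_leq; apply: eq_card => g; rewrite [RHS]inE unfold_in /= andbA.
    apply: (leq_card_inj (phi := tt)) => [g|g g' _ _ /invr_inj /addrI /oppr_inj //].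
    rewrite [_ \in [set _ | _ ]]inE => /and3P[gG g1 /eqP hth].
    have g0 : 1 - g != 0 by rewrite subr_eq0 eq_sym.
    rewrite in_shifted_fiber1 hth eqxx andbT /tt invr_eq0 g0 /= invr_eq1.
    by rewrite -subr_eq0 addrAC subrr add0r oppr_eq0 Gn0.
  apply: leq_trans (_ : n * M + n * (M + M + M) <= _)%N; last by lia.
  apply: leq_add.
    rewrite /sides !cardsX /= subrr card_differences0 // leq_mul2l nM orbT.
    by [].
  have side3 (h : F -> nat) : (forall g, g \in G -> g != 1 -> h g = (n * #|differences n (1 - g)%R| ^ 2)%N) ->
      (\sum_(g in G | g != 1%R) h g <= n * M)%N.
    move=> hh; rewrite (eq_bigr (fun g => n * #|differences n (1 - g)%R| ^ 2)%N).
      by rewrite -big_distrr /= leq_mul2l hQ orbT.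
    by move=> g /andP[gG g1]; rewrite hh.
  have opp g : #|differences n (g - 1)| = #|differences n (1 - g)|.
    by rewrite -card_differences_opp opprB.
  rewrite !mulnDr !big_split /= !leq_add //; apply: side3 => g gG g1;
    by rewrite /sides !cardsX /= ?subrr ?opp ?card_differences0 // -mulnn; ring.
pose P := finset.setX (finset.setX (finset.setX G G) (finset.setX G G)) (finset.setX G G).
pose f (x : (F * F) * (F * F) * (F * F)) :=
  (x.1.1.1 + x.1.1.2, x.1.2.1 + x.1.2.2, x.2.1 + x.2.2).
have e3 : (energy2 G ^ 3 = coll P f)%N.
  pose add (x : F * F) := x.1 + x.2.
  have h1 : coll P f = (coll (finset.setX (finset.setX G G) (finset.setX G G))
      (fun x => (add x.1, add x.2)) * coll (finset.setX G G) add)%N by exact: coll_setX.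
  have h2 : coll (finset.setX (finset.setX G G) (finset.setX G G))
      (fun x => (add x.1, add x.2)) = (coll (finset.setX G G) add * coll (finset.setX G G) add)%N.
    exact: coll_setX.
  by rewrite h1 h2 !expnS expn0 muln1 mulnA.
have hE : (energy2 G ^ 3 <= n ^ 4 * (4 * (n * M) + X))%N.
  rewrite e3; apply: leq_trans (coll_refine (g := fun x : (F * F) * (F * F) * (F * F) => x.1.1.1 * x.1.2.1 * x.2.1) (Q := G) _ _) _.
    move=> [[[x1 h1] [x2 h2]] [x3 h3]]; rewrite !in_setX /=.
    by move=> /andP[/andP[/andP[? _] /andP[? _]] /andP[? _]]; rewrite !unity_rootsM.
  rewrite hG expnS -mulnA leq_mul2l; apply/orP; right.
  apply: leq_trans (_ : n ^ 3 * (\sum_(x in finset.setX G G) #|sides x|) <= _)%N; last first.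
    by rewrite leq_mul2l hW orbT.
  pose S := finset.setX (finset.setX (finset.setX G G) G) [set x : (F * F) * ((F * F) * ((F * F) * (F * F))) |
     (x.1 \in finset.setX G G) && (x.2 \in sides x.1)].
  have -> : (n ^ 3 * (\sum_(x in finset.setX G G) #|sides x|))%N = #|S|.
    by rewrite cardsX card_dependent !cardsX hG !expnS expn0 muln1 mulnA.
  (* The triangle is the one used for [energy3], with x_i - y_i = g_i - h_i in place of a_i - b_i.
     Rescaling by the group makes each side a difference of two group elements. The n^3 choices of
     (x1, x2, x3) and the factor n from refining give n^4. *)
  pose phi (ij : ((F * F) * (F * F) * (F * F)) * ((F * F) * (F * F) * (F * F))) :=
    let: (((x1, h1), (x2, h2), (x3, h3)), ((y1, g1), (y2, g2), (y3, g3))) := ij in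
    ((x1, x2, x3), ((y1 / x1, y1 * y2 / (x1 * x2)),
      ((g1 / x1, h1 / x1), ((y1 * g2 / (x1 * x2), y1 * h2 / (x1 * x2)), (g3 / y3, h3 / y3))))).
  apply: (leq_coll_inj (phi := phi)).
    move=> [[[x1 h1] [x2 h2]] [x3 h3]] [[[y1 g1] [y2 g2]] [y3 g3]]; rewrite !in_setX /=.
    move=> /andP[/andP[/andP[x1G h1G] /andP[x2G h2G]] /andP[x3G h3G]].
    move=> /andP[/andP[/andP[y1G g1G] /andP[y2G g2G]] /andP[y3G g3G]] [s1 s2 s3 pr].
    have x10 := Gn0 _ x1G. have x20 := Gn0 _ x2G. have x30 := Gn0 _ x3G.
    have y10 := Gn0 _ y1G. have y20 := Gn0 _ y2G. have y30 := Gn0 _ y3G.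
    have pr' : x1 * x2 * x3 = y1 * y2 * y3 := pr.
    have d1 : x1 - y1 = g1 - h1 by apply/eqP; rewrite subr_eq addrAC eq_sym subr_eq addrC -s1.
    have d2 : x2 - y2 = g2 - h2 by apply/eqP; rewrite subr_eq addrAC eq_sym subr_eq addrC -s2.
    have d3 : x3 - y3 = g3 - h3 by apply/eqP; rewrite subr_eq addrAC eq_sym subr_eq addrC -s3.
    rewrite x1G x2G x3G /= inE /= in_setX /= /sides !in_setX /= ![_ \in differences _ _]inE /=.
    rewrite !unity_rootsD ?unity_rootsM //=; apply/and3P; split; apply/eqP.
    - by rewrite -mulrBl -d1; field.
    - by rewrite -mulrBl -mulrBr -d2; field; rewrite x20 x10.
    - have -> : y1 * y2 / (x1 * x2) = x3 / y3.
        by apply/eqP; rewrite eqr_div ?mulf_neq0 // -pr' mulrC.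
      by rewrite -mulrBl -d3; field.
  move=> [[[x1 h1] [x2 h2]] [x3 h3]] [[[y1 g1] [y2 g2]] [y3 g3]].
  move=> [[[x1' h1'] [x2' h2']] [x3' h3']] [[[y1' g1'] [y2' g2']] [y3' g3']]; rewrite !in_setX /=.
  move=> /andP[/andP[/andP[x1G h1G] /andP[x2G h2G]] /andP[x3G h3G]].
  move=> /andP[/andP[/andP[y1G g1G] /andP[y2G g2G]] /andP[y3G g3G]] _.
  move=> /andP[/andP[/andP[y1G' _] /andP[y2G' _]] /andP[y3G' _]].
  move=> [_ _ _ pr] [_ _ _ pr'] [].
  have iV (z : F) : z \in G -> z^-1 != 0 by rewrite invr_eq0 => /Gn0.
  move=> ex1 ex2 ex3; subst x1' x2' x3'.
  move=> /(mulIf (iV _ x1G)) ey1; subst y1'.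
  have m0 : (x1 * x2)^-1 != 0 by rewrite invr_eq0 mulf_neq0 // Gn0.
  move=> /(mulIf m0) /(mulfI (Gn0 _ y1G)) ey2; subst y2'.
  have /mulfI ey3 : y1 * y2 * y3 = y1 * y2 * y3' by exact: etrans (esym pr) pr'.
  have {}ey3 : y3 = y3' by apply: ey3; rewrite mulf_neq0 // Gn0.
  subst y3'.
  move=> /(mulIf (iV _ x1G)) -> /(mulIf (iV _ x1G)) ->.
  move=> /(mulIf m0) /(mulfI (Gn0 _ y1G)) -> /(mulIf m0) /(mulfI (Gn0 _ y1G)) ->.
  by move=> /(mulIf (iV _ y3G)) -> /(mulIf (iV _ y3G)) ->.
have -> : (energy2 G ^ 9 = (energy2 G ^ 3) ^ 3)%N by rewrite -expnM.
apply: leq_trans (_ : (n ^ 4 * (4 * (n * M) + X)) ^ 3 <= _)%N; first by rewrite leq_exp2r.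
rewrite expnMn -expnM -[X in (_ <= X)%N]mulnA [X in (_ <= X)%N]mulnCA.
rewrite leq_mul2l; apply/orP; right.
have nM3 : ((n * M) ^ 3 <= M ^ 5)%N.
  rewrite expnMn -[5%N]/(2 + 3)%N expnD leq_mul2r; apply/orP; right.
  rewrite expnS -mulnn leq_mul //.
  by apply: leq_trans nM; rewrite leq_pmulr.
have cube a b c : (a ^ 3 <= c -> b ^ 3 <= c -> (a + b) ^ 3 <= 8 * c)%N.
  move=> ac bc; apply: leq_trans (_ : (2 * maxn a b) ^ 3 <= _)%N.
    by rewrite leq_exp2r // mul2n -addnn leq_add ?leq_maxl ?leq_maxr.
  by rewrite expnMn leq_mul2l /=; case: (leqP a b).
(* 64 M^5 bounds both cubes, since n^3 <= M^2 and X^3 <= M^5; adding the two summands costs the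
   factor 8. *)
rewrite -[512%N]/(8 * 64)%N -[(8 * 64 * _)%N]mulnA; apply: cube.
  by rewrite expnMn leq_mul2l nM3.
by apply: leq_trans hX _; rewrite leq_pmull.
Qed.

(** * Lattice points and multiplicative collisions *)

Definition sup_norm (v : int * int) : nat := maxn `|v.1|%N `|v.2|%N.

Lemma intr_pchar_eq0 (F : fieldType) p (m : int) : p \in [pchar F] ->
  (m%:~R == 0 :> F) = (p %| `|m|)%N.
Proof.
move=> pF; rewrite (dvdn_pcharf pF); case: (intP m) => [|k|k]; first by rewrite absz0.
  by [].
by rewrite abszN mulrNz oppr_eq0.
Qed.

Lemma intr_small_eq0 (F : fieldType) p (m : int) : p \in [pchar F] ->
  (`|m| < p)%N -> (m%:~R == 0 :> F) = (m == 0).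
Proof.
move=> pF mp; rewrite (intr_pchar_eq0 _ pF) -absz_eq0; apply/idP/idP => [|/eqP -> //].
have [->|m0] := posnP `|m|%N; first by [].
by move=> /(dvdn_leq m0); rewrite leqNgt mp.
Qed.

(* The lattice is {(x, y) : x = h y in F}. *)
Definition shortest (F : fieldType) (h : F) (v : int * int) : Prop :=
  [/\ v != (0, 0), v.1%:~R = h * v.2%:~R &
      forall w, w != (0, 0) -> w.1%:~R = h * w.2%:~R -> (sup_norm v <= sup_norm w)%N].

Lemma sup_norm_gt0 (v : int * int) : v != (0, 0) -> (0 < sup_norm v)%N.
Proof.
by case: v => x y; rewrite xpair_eqE /sup_norm /= negb_and -!absz_gt0 leq_max.
Qed.

(** Thue's pigeonhole argument: with s the integer square root of p, the box has (s + 1)^2 > p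
    points (x, y), two of which share the value x - h y. *)
Lemma exists_shortest (F : finFieldType) p (h : F) : p \in [pchar F] -> #|F| = p ->
  exists2 v, shortest h v & (sup_norm v * sup_norm v <= p)%N.
Proof.
move=> pF cF.
have [s sp ps] : exists2 s, (s * s <= p)%N & (p < s.+1 * s.+1)%N.
  have ex : exists s, (p < s.+1 * s.+1)%N by exists p; nia.
  case: (ex_minnP ex) => -[|s] hs smin; first by exists 0%N.
  exists s.+1 => //; rewrite leqNgt; apply/negP => /smin; lia.
have [w w0 [wh ws]] : exists2 w : int * int, w != (0, 0) &
    w.1%:~R = h * w.2%:~R /\ (sup_norm w <= s)%N.
  pose phi (u : 'I_s.+1 * 'I_s.+1) : F := (u.1 : nat)%:R - h * (u.2 : nat)%:R.
  have : ~~ injectiveb phi.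
    apply/negP => /injectiveP inj; have := leq_card phi inj.
    by rewrite card_prod !card_ord cF leqNgt ps.
  move=> /injectivePn[u [u' uu' e]].
  exists ((u.1 : nat)%:Z - (u'.1 : nat)%:Z, (u.2 : nat)%:Z - (u'.2 : nat)%:Z).
    rewrite xpair_eqE /= !subr_eq0 !eqz_nat; apply: contra uu'.
    by case: u u' {e} => [a b] [c d] /= /andP[/eqP/val_inj -> /eqP/val_inj ->].
  split => /=.
    rewrite !rmorphB /= mulrBr; apply/eqP; rewrite -subr_eq0; apply/eqP.
    by move: e; rewrite /phi => /eqP; rewrite -subr_eq0 => /eqP <-; rewrite /= -!pmulrn; ring.
  have := ltn_ord u.1; have := ltn_ord u.2; have := ltn_ord u'.1; have := ltn_ord u'.2.
  by rewrite /sup_norm /= geq_max; lia.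
pose Q m := `[< exists v, [/\ v != (0, 0), v.1%:~R = h * v.2%:~R & sup_norm v = m] >].
have exQ : exists m, Q m by exists (sup_norm w); apply/asboolP; exists w.
case: (ex_minnP exQ) => m /asboolP[v [v0 vh vm]] mmin.
have vmin u : u != (0, 0) -> u.1%:~R = h * u.2%:~R -> (sup_norm v <= sup_norm u)%N.
  by move=> u0 uh; rewrite vm; apply: mmin; apply/asboolP; exists u.
exists v => //; apply: leq_trans sp; apply: leq_mul; apply: leq_trans (vmin w w0 wh) ws.
Qed.

Lemma shortest_lt (F : fieldType) p (v : int * int) : p \in [pchar F] ->
  (sup_norm v * sup_norm v <= p)%N -> (sup_norm v < p)%N.
Proof.
move=> /pcharf_prime /prime_gt1 p1 vp; rewrite ltnNge; apply/negP => pv.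
have := leq_mul pv pv; move: vp; nia.
Qed.

(** A common divisor is smaller than p, hence invertible in F, and dividing by it would give a
    shorter lattice vector. *)
Lemma shortest_coprime (F : finFieldType) p (h : F) v : p \in [pchar F] ->
  (sup_norm v * sup_norm v <= p)%N -> shortest h v -> coprimez v.1 v.2.
Proof.
move=> pF vp [v0 vh vmin].
have vltp := shortest_lt pF vp.
have vg := sup_norm_gt0 v0.
have [d dE] : exists d, d = gcdz v.1 v.2 by eexists.
have dge0 : 0 <= d by rewrite dE.
have [x ex] : exists x, v.1 = x * d by apply/dvdzP; rewrite dE; exact: dvdz_gcdl.
have [y ey] : exists y, v.2 = y * d by apply/dvdzP; rewrite dE; exact: dvdz_gcdr.
have normE : sup_norm v = (sup_norm (x, y) * `|d|)%N.
  by rewrite /sup_norm /= ex ey !abszM maxnMl.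
have xy0 : (x, y) != (0, 0).
  by apply: contraTneq vg => -[x0 y0]; rewrite normE x0 y0 /sup_norm /= ?maxnn ?mul0n.
have d0 : (0 < `|d|)%N.
  by move: vg; rewrite normE muln_gt0 => /andP[].
have dF : d%:~R != 0 :> F.
  rewrite (intr_small_eq0 pF) -?absz_gt0 //.
  apply: leq_ltn_trans vltp; rewrite normE leq_pmull //; exact: sup_norm_gt0.
have e : x%:~R = h * y%:~R :> F.
  by apply: (mulIf dF); rewrite -mulrA -!rmorphM /= -ex -ey.
have := vmin (x, y) xy0 e; rewrite normE.
rewrite -[X in (_ <= X)%N -> _]muln1 leq_pmul2l ?sup_norm_gt0 // => d1.
by rewrite /coprimez -dE; lia.
Qed.

(* Points of a box whose differences lie in the lattice: the determinant
   against the shortest vector is a multiple of p, which leaves few lines, and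
   the points on one line differ by multiples of that vector. *)
Lemma card_box (F : finFieldType) p (h : F) v M (S : {set 'I_M.+1 * 'I_M.+1}) :
  p \in [pchar F] -> (sup_norm v * sup_norm v <= p)%N -> shortest h v ->
  (forall u w, u \in S -> w \in S ->
    ((u.1 : nat)%:Z - (w.1 : nat)%:Z)%:~R = h * ((u.2 : nat)%:Z - (w.2 : nat)%:Z)%:~R) ->
  (#|S| <= (2 * ((2 * sup_norm v * M) %/ p) + 1) * (M %/ sup_norm v + 1))%N /\
  ((M < sup_norm v)%N -> (#|S| <= 1)%N).
Proof.
move=> pF vp sv hS; have [v0 vh vmin] := sv.
have vg := sup_norm_gt0 v0; have p0 := prime_gt0 (pcharf_prime pF).
split; last first.
  move=> Mv; apply/card_le1_eqP => u w uS wS; apply/eqP/negPn/negP => uw.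
  have := vmin ((u.1 : nat)%:Z - (w.1 : nat)%:Z, (u.2 : nat)%:Z - (w.2 : nat)%:Z).
  have ne : ((u.1 : nat)%:Z - (w.1 : nat)%:Z, (u.2 : nat)%:Z - (w.2 : nat)%:Z) != (0, 0).
    rewrite xpair_eqE /= !subr_eq0 !eqz_nat; apply: contra uw; case: u w {uS wS} => [a b] [c d] /=.
    by move=> /andP[/eqP/val_inj -> /eqP/val_inj ->].
  move=> /(_ ne (hS u w uS wS)); apply/negP; rewrite -ltnNge; apply: leq_ltn_trans Mv.
  have := ltn_ord u.1; have := ltn_ord u.2; have := ltn_ord w.1; have := ltn_ord w.2.
  by rewrite /sup_norm geq_max /=; lia.
have [->|[w wS]] := set_0Vmem S; first by rewrite cards0.
have cop := shortest_coprime pF vp sv.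
pose det (u : 'I_M.+1 * 'I_M.+1) : int :=
  v.1 * ((u.2 : nat)%:Z - (w.2 : nat)%:Z) - v.2 * ((u.1 : nat)%:Z - (w.1 : nat)%:Z).
pose K := ((2 * sup_norm v * M) %/ p)%N.
have detP u : u \in S -> exists2 k : int, det u = k * p%:Z & (`|k| <= K)%N.
  move=> uS; have : (p %| `|det u|)%N.
    rewrite -(intr_pchar_eq0 _ pF) /det rmorphB /= !rmorphM /= vh.
    have := hS u w uS wS; rewrite !rmorphB /= => ->; apply/eqP; ring.
  rewrite -[p]/(`|p%:Z|)%N -dvdzE => /dvdzP[k ek]; exists k => //.
  rewrite /K leq_divRL //.
  have <- : `|det u|%N = (`|k| * p)%N by rewrite ek abszM.
  have := ltn_ord u.1; have := ltn_ord u.2; have := ltn_ord w.1; have := ltn_ord w.2.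
  have v1 : (`|v.1| <= sup_norm v)%N by rewrite leq_maxl.
  have v2 : (`|v.2| <= sup_norm v)%N by rewrite leq_maxr.
  rewrite /det; set a := ((u.2 : nat)%:Z - _); set b := ((u.1 : nat)%:Z - _) => h1 h2 h3 h4.
  have ha : (`|a| <= M)%N by rewrite /a; lia.
  have hb : (`|b| <= M)%N by rewrite /b; lia.
  have := leq_mul v1 ha; have := leq_mul v2 hb; rewrite -!abszM; lia.
pose line (u : 'I_M.+1 * 'I_M.+1) : int := (det u %/ p%:Z)%Z.
have lineE u : u \in S -> det u = line u * p%:Z /\ (`|line u| <= K)%N.
  move=> /detP[k ek kK]; rewrite /line ek mulzK //; last by rewrite -absz_gt0.
(* In the coordinate where v attains its sup norm, distinct points of one line differ by at least
   [sup_norm v], hence fall into different blocks of that length. *)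
pose coordinate (u : 'I_M.+1 * 'I_M.+1) : nat := if (`|v.1| == sup_norm v)%N then u.1 else u.2.
pose phi (u : 'I_M.+1 * 'I_M.+1) : 'I_(2 * K).+1 * 'I_(M %/ sup_norm v).+1 :=
  (inord `|line u + K%:Z|, inord (coordinate u %/ sup_norm v)).
apply: leq_trans (_ : #|[set: 'I_(2 * K).+1 * 'I_(M %/ sup_norm v).+1]| <= _)%N; last first.
  by rewrite cardsT card_prod !card_ord !addn1.
apply: (leq_card_inj (phi := phi)) => [u|u u' uS u'S [/(congr1 val) e1 /(congr1 val) e2]]; first by rewrite inE.
have [du lu] := lineE u uS; have [du' lu'] := lineE u' u'S.
have cM x : (coordinate x <= M)%N by rewrite /coordinate; case: ifP; rewrite -ltnS.
move: e1 e2; rewrite /= !inordK ?ltnS ?leq_div2r //; try lia.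
move=> e1 e2; have el : line u = line u' by lia.
have {}el : det u = det u' by rewrite du du' el.
pose a : int := (u.1 : nat)%:Z - (u'.1 : nat)%:Z.
pose b : int := (u.2 : nat)%:Z - (u'.2 : nat)%:Z.
have par : v.1 * b = v.2 * a.
  apply/eqP; rewrite -subr_eq0.
  have -> : v.1 * b - v.2 * a = det u - det u' by rewrite /det /a /b; ring.
  by rewrite el subrr.
have [x [y xy]] := Bezoutz v.1 v.2.
have xy1 : x * v.1 + y * v.2 = 1.
  by rewrite xy; apply/eqP; exact: cop.
pose t := x * a + y * b.
have at_ : a = t * v.1.
  transitivity (a * (x * v.1 + y * v.2)); first by rewrite xy1 mulr1.
  have -> : t * v.1 = x * a * v.1 + y * (v.1 * b) by rewrite /t; ring.
  by rewrite par; ring.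
have bt : b = t * v.2.
  transitivity (b * (x * v.1 + y * v.2)); first by rewrite xy1 mulr1.
  have -> : t * v.2 = x * (v.2 * a) + y * b * v.2 by rewrite /t; ring.
  by rewrite -par; ring.
have t0 : t = 0.
  apply/eqP/negPn/negP; rewrite -absz_gt0 => tg.
  have le : (sup_norm v <= `|(coordinate u)%:Z - (coordinate u')%:Z|)%N.
    rewrite /coordinate; case: eqP => [e|ne].
      by rewrite -/a at_ abszM -e leq_pmull.
    have e : `|v.2|%N = sup_norm v.
      by move: ne; rewrite /sup_norm /maxn; case: ifP.
    by rewrite -/b bt abszM -e leq_pmull.
  have := divn_eq (coordinate u) (sup_norm v); have := divn_eq (coordinate u') (sup_norm v).
  have := ltn_pmod (coordinate u) vg; have := ltn_pmod (coordinate u') vg.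
  by rewrite e2; lia.
move: at_ bt; rewrite t0 !mul0r /a /b => /eqP + /eqP; rewrite !subr_eq0 !eqz_nat.
by case: u u' {uS u'S e1 e2 el a b par t t0 du lu du' lu'} => [? ?] [? ?] /= /eqP/val_inj -> /eqP/val_inj ->.
Qed.

(* The divisor bound *)
Local Close Scope ring_scope.

Lemma size_divisors_pfactor (q m : nat) : prime q -> 0 < m ->
  size (divisors m) <= (logn q m).+1 * size (divisors (m %/ q ^ logn q m)).
Proof.
move=> pq m0; set e := logn q m; set m' := m %/ q ^ e.
have mE : m = m' * q ^ e by rewrite divnK // pfactor_dvdnn.
have m'0 : 0 < m' by move: m0; rewrite mE muln_gt0 => /andP[].
have cop : coprime q m'.
  have [n cn nE] := pfactor_coprime pq m0.
  by rewrite /m' /e {1}nE mulnK // pfactor_gt0.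
pose s := [seq q ^ i * d | i <- iota 0 e.+1, d <- divisors m'].
have sub : {subset divisors m <= s}.
  move=> d; rewrite -dvdn_divisors // => dm.
  have d0 : 0 < d by exact: dvdn_gt0 dm.
  have [d' cd' dE] := pfactor_coprime pq d0.
  apply/allpairsP; exists (logn q d, d'); split.
  - by rewrite mem_iota /= ltnS dvdn_leq_log.
  - rewrite -dvdn_divisors //=.
    have : d' %| m by apply: dvdn_trans dm; rewrite dE dvdn_mulr.
    by rewrite mE Gauss_dvdl // coprimeXr // coprime_sym.
  - by rewrite /= mulnC.
apply: leq_trans (uniq_leq_size (divisors_uniq m) sub) _.
by rewrite size_allpairs size_iota.
Qed.

Lemma leq_exp2rW a b k : a <= b -> a ^ k <= b ^ k.
Proof. by case: k => [//|k] ab; rewrite leq_exp2r. Qed.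

(** From a + 1 <= k 2^(a %/ k). It serves for the small primes in the divisor bound, and again to
    bound the logarithm of p by a constant times p^(1/k). *)
Lemma succ_exp_bound k a : a.+1 ^ k <= k ^ k * 2 ^ a.
Proof.
have [->|k0] := posnP k; first by rewrite expn0 mul1n expn_gt0.
apply: leq_trans (_ : (k * 2 ^ (a %/ k)) ^ k <= _).
  apply: leq_exp2rW; apply: leq_trans (ltn_ceil a k0) _.
  by rewrite mulnC leq_mul2l ltn_expl ?orbT.
by rewrite expnMn leq_mul2l -expnM leq_exp2l // leq_trunc_div orbT.
Qed.

Lemma divisors_bound_above k (q : nat) : 2 ^ k <= q ->
  forall m, 0 < m -> (forall r, r < q -> prime r -> ~~ (r %| m)) ->
  size (divisors m) ^ k <= m.
Proof.
move=> kq m; elim: {m}m.+1 {-2}m (ltnSn m) => // s IH m ms m0 hm.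
have [m1|m1] := leqP m 1.
  have -> : m = 1 by lia.
  by rewrite (_ : size (divisors 1) = 1) // exp1n.
have [r pr rm] := pdivP m1.
have rq : q <= r by rewrite leqNgt; apply/negP => /hm /(_ pr); rewrite rm.
set e := logn r m; set m' := m %/ r ^ e.
have mE : m = m' * r ^ e by rewrite divnK // pfactor_dvdnn.
have m'0 : 0 < m' by move: m0; rewrite mE muln_gt0 => /andP[].
have e0 : 0 < e by rewrite logn_gt0 mem_primes pr m0 rm.
have m'm : m' < m.
  rewrite [X in _ < X]mE -[X in X < _]muln1 ltn_pmul2l // -(exp1n e) ltn_exp2r //.
  exact: prime_gt1.
have h' : size (divisors m') ^ k <= m'.
  apply: IH => // [|r' r'q pr']; first by lia.
  by apply: contra (hm r' r'q pr') => /dvdn_trans; apply; rewrite mE dvdn_mulr.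
apply: leq_trans (_ : (e.+1 * size (divisors m')) ^ k <= _).
  apply: leq_exp2rW; exact: size_divisors_pfactor.
rewrite expnMn mulnC mE -/m' -/e leq_mul //.
apply: leq_trans (_ : (2 ^ e) ^ k <= _).
  apply: leq_exp2rW; exact: ltn_expl.
rewrite -expnM mulnC expnM; case: e {mE m'm e0 m' m'0 h'} => [//|e].
by rewrite leq_exp2r //; apply: leq_trans kq rq.
Qed.

(* Primes r >= 2^k cost nothing, since (e + 1)^k <= 2^(e k) <= r^e; each of the
   finitely many smaller primes costs a constant factor k^k. *)
Lemma divisors_bound k : exists2 C, 0 < C & forall m, 0 < m -> size (divisors m) ^ k <= C * m.
Proof.
(* Induction on the distance s from q up to 2^k, for m free of primes below q; at q = 0 this is no
   restriction. *)
suff gen s q : q + s = 2 ^ k -> exists2 C, 0 < C & forall m, 0 < m ->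
    (forall r, r < q -> prime r -> ~~ (r %| m)) -> size (divisors m) ^ k <= C * m.
  have [//|C C0 hC] := gen (2 ^ k) 0.
  by exists C => // m m0; exact: hC.
elim: s q => [|s IH] q e.
  rewrite addn0 in e; exists 1 => // m m0 hm; rewrite mul1n.
  by apply: (divisors_bound_above (q := q)) => //; rewrite e.
have [|C C0 hC] := IH q.+1; first by rewrite addSnnS.
exists (k ^ k * C) => [|m m0 hm].
  by rewrite muln_gt0 C0 expn_gt0 orbC; case: (k).
have [pq|npq] := boolP (prime q); last first.
  apply: leq_trans (hC m m0 _) _ => [r|].
    rewrite ltnS leq_eqVlt => /orP[/eqP -> pq|]; last exact: hm.
    by rewrite pq in npq.
  by rewrite -mulnA leq_pmull // expn_gt0 orbC; case: (k).
set f := logn q m; set m' := m %/ q ^ f.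
have mE : m = m' * q ^ f by rewrite divnK // pfactor_dvdnn.
have m'0 : 0 < m' by move: m0; rewrite mE muln_gt0 => /andP[].
have cop : coprime q m'.
  have [n cn nE] := pfactor_coprime pq m0.
  by rewrite /m' /f {1}nE mulnK // pfactor_gt0.
have h' : size (divisors m') ^ k <= C * m'.
  apply: hC => // r; rewrite ltnS leq_eqVlt => /orP[/eqP -> _|rq pr].
    by rewrite -prime_coprime.
  by apply: contra (hm r rq pr) => /dvdn_trans; apply; rewrite mE dvdn_mulr.
apply: leq_trans (_ : (f.+1 * size (divisors m')) ^ k <= _).
  apply: leq_exp2rW; exact: size_divisors_pfactor.
rewrite expnMn {1}mE -/m' -/f.
apply: leq_trans (_ : (k ^ k * 2 ^ f) * (C * m') <= _).
  by rewrite leq_mul // succ_exp_bound.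
have -> : k ^ k * C * (m' * q ^ f) = (k ^ k * q ^ f) * (C * m') by ring.
rewrite leq_mul2r leq_mul2l; apply/orP; right; apply/orP; right.
by apply: leq_exp2rW; exact: prime_gt1.
Qed.

Local Open Scope ring_scope.

(** * Counting short lattice vectors *)

Lemma leq_card_fibers (I J : finType) (f : I -> J) (P : {set I}) (Q : {set J}) c :
  {in P, forall i, f i \in Q} ->
  (forall y, y \in Q -> (#|[set i in P | f i == y]| <= c)%N) -> (#|P| <= c * #|Q|)%N.
Proof.
move=> PQ hc; rewrite -sum1_card (partition_big f (mem Q)) //=.
rewrite mulnC -sum_nat_const; apply: leq_sum => y yQ.
apply: leq_trans (hc y yQ); rewrite -sum1_card.
by apply: eq_leq; apply: eq_bigl => i; rewrite inE.
Qed.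

(** Merges the two regimes of [card_box]. If |v| <= M, the product of the two counts expands into 1,
    M/|v|, 4 |v| M/p and 4 M^2/p, and |v| M <= M^2; hence 8 = 4 + 4. *)
Lemma card_box_real (R : realFieldType) (F : finFieldType) p (h : F) v M
    (S : {set 'I_M.+1 * 'I_M.+1}) :
  p \in [pchar F] -> (sup_norm v * sup_norm v <= p)%N -> shortest h v ->
  (forall u w, u \in S -> w \in S ->
    ((u.1 : nat)%:Z - (w.1 : nat)%:Z)%:~R = h * ((u.2 : nat)%:Z - (w.2 : nat)%:Z)%:~R) ->
  #|S|%:R <= 1 + M%:R / (sup_norm v)%:R + 8 * M%:R ^+ 2 / p%:R :> R.
Proof.
move=> pF vp sv hS; have [c1 c2] := card_box pF vp sv hS.
have [v0 _ _] := sv; have vg := sup_norm_gt0 v0.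
have p0 := prime_gt0 (pcharf_prime pF).
have vR : 0 < (sup_norm v)%:R :> R by rewrite ltr0n.
have pR : 0 < p%:R :> R by rewrite ltr0n.
have [Mv|vM] := ltnP M (sup_norm v).
  apply: le_trans (_ : 1 <= _); first by rewrite lern1 c2.
  by rewrite -addrA lerDl addr_ge0 // ?divr_ge0 ?mulr_ge0 ?ler0n ?exprn_ge0 ?ler0n.
apply: le_trans (_ : ((2 * ((2 * sup_norm v * M) %/ p) + 1) * (M %/ sup_norm v + 1))%N%:R <= _).
  by rewrite ler_nat.
have dv a b : (0 < b)%N -> ((a %/ b)%N%:R : R) <= a%:R / b%:R.
  by move=> b0; rewrite ler_pdivlMr ?ltr0n // -natrM ler_nat leq_trunc_div.
rewrite natrM natrD natrM natrD.
set x := M%:R / (sup_norm v)%:R; pose y : R := M%:R * (sup_norm v)%:R / p%:R.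
have h1 : ((2 * sup_norm v * M) %/ p)%N%:R <= 2 * y :> R.
  apply: le_trans (dv _ _ p0) _; rewrite !natrM /y; lra.
have h2 : (M %/ sup_norm v)%N%:R <= x by exact: dv.
have x0 : 0 <= x by rewrite divr_ge0 ?ler0n.
have y0 : 0 <= y by rewrite divr_ge0 ?mulr_ge0 ?ler0n.
have yM : y <= M%:R ^+ 2 / p%:R.
  rewrite /y ler_pM2r ?invr_gt0 // expr2 ler_wpM2l ?ler0n // ler_nat //.
have xy : x * y = M%:R ^+ 2 / p%:R by rewrite /x /y; field; rewrite !lt0r_neq0.
apply: le_trans (_ : (2 * (2 * y) + 1) * (x + 1) <= _).
  by rewrite ler_pM ?addr_ge0 ?mulr_ge0 ?ler0n // lerD2r // ler_pM2l // ltr0n.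
have -> : (2 * (2 * y) + 1) * (x + 1) = 4 * (x * y) + 4 * y + x + 1 by ring.
rewrite xy -[8 * _ / _]mulrA; lra.
Qed.

Definition lattice_box (F : finFieldType) (k : F) M : {set 'I_(2 * M).+1 * 'I_(2 * M).+1} :=
  [set u : 'I_(2 * M).+1 * 'I_(2 * M).+1 | (((u.1 : nat)%:Z - M%:Z, (u.2 : nat)%:Z - M%:Z) != (0, 0)) &&
    (((u.1 : nat)%:Z - M%:Z)%:~R == k * ((u.2 : nat)%:Z - M%:Z)%:~R)].

(** A constant term would contribute n after summation over the group. Adjoining the origin, which
    [lattice_box] excludes, cancels the 1 of the general count. *)
Lemma card_lattice_box (R : realFieldType) (F : finFieldType) p (k : F) v M :
  p \in [pchar F] -> (sup_norm v * sup_norm v <= p)%N -> shortest k v ->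
  #|lattice_box k M|%:R <= 2 * M%:R / (sup_norm v)%:R + 32 * M%:R ^+ 2 / p%:R :> R.
Proof.
move=> pF vp sv.
pose o : 'I_(2 * M).+1 * 'I_(2 * M).+1 := (inord M, inord M).
have oM : (inord M : 'I_(2 * M).+1) = M :> nat by rewrite inordK // ltnS leq_pmull.
have := card_box_real R (S := o |: lattice_box k M) pF vp sv.
have on : o \notin lattice_box k M by rewrite inE /o /= oM !subrr eqxx.
rewrite cardsU1 on add1n -natr1 natrM => h.
have : #|lattice_box k M|%:R + 1 <= 1 + 2 * M%:R / (sup_norm v)%:R + 8 * (2 * M%:R) ^+ 2 / p%:R :> R.
  apply: h => u w uS wS.
  have key z : z \in o |: lattice_box k M -> ((z.1 : nat)%:Z - M%:Z)%:~R = k * ((z.2 : nat)%:Z - M%:Z)%:~R.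
    rewrite in_setU1 => /orP[/eqP ->|]; first by rewrite /o /= oM !subrr mulr0.
    by rewrite inE => /andP[_ /eqP].
  have := key u uS; have := key w wS; rewrite !rmorphB /= => hw hu.
  apply/eqP; rewrite -subr_eq0; apply/eqP.
  transitivity (((u.1 : nat)%:~R - M%:~R - k * ((u.2 : nat)%:~R - M%:~R)) - ((w.1 : nat)%:~R - M%:~R - k * ((w.2 : nat)%:~R - M%:~R)) : F); first by ring.
  by rewrite hw hu !subrr.
have -> : 8 * (2 * M%:R) ^+ 2 / p%:R = 32 * M%:R ^+ 2 / p%:R :> R by ring.
lra.
Qed.

(* Products of short vectors are short vectors of the product class, and the
   divisor bound controls the multiplicity. *)
Lemma short_vectors_square (F : finFieldType) p n (sv : F -> int * int) j D :
  p \in [pchar F] -> (0 < n)%N ->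
  (forall h, shortest h (sv h)) -> (forall h, (sup_norm (sv h) * sup_norm (sv h) <= p)%N) ->
  (forall m, (0 < m <= 4 * 4 ^ j)%N -> (size (divisors m) <= D)%N) ->
  (#|[set h in unity_roots F n | trunc_log 2 (sup_norm (sv h)) == j]| ^ 2 <=
   4 * D ^ 2 * \sum_(k in unity_roots F n) #|lattice_box k (4 * 4 ^ j)|)%N.
Proof.
move=> pF n0 hsv hp hD; set M := (4 * 4 ^ j)%N; set Hj := [set h in _ | _].
have HjP h : h \in Hj -> [/\ h \in unity_roots F n, h != 0, (sup_norm (sv h) < 2 * 2 ^ j)%N,
    (sv h).1 != 0 & (sv h).2 != 0].
  rewrite inE => /andP[hG /eqP hj]; have h0 := unity_roots_neq0 n0 hG.
  have [v0 vh _] := hsv h; have vlt := shortest_lt pF (hp h).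
  have v2 : (sv h).2 != 0.
    apply/eqP => y0; move: vh; rewrite y0 mulr0 => /eqP.
    rewrite (intr_small_eq0 pF); last by apply: leq_ltn_trans vlt; exact: leq_maxl.
    by move=> /eqP x0; move: v0; case: (sv h) x0 y0 => a b /= -> ->; rewrite eqxx.
  split => //.
    by rewrite -expnS -hj trunc_log_ltn.
  apply: contra v2 => /eqP x0; move: vh; rewrite x0 => /esym/eqP.
  rewrite mulf_eq0 (negPf h0) /= (intr_small_eq0 pF) //.
  by apply: leq_ltn_trans vlt; exact: leq_maxr.
pose X (h : F * F) : int := (sv h.1).1 * (sv h.2).1.
pose Y (h : F * F) : int := (sv h.1).2 * (sv h.2).2.
have normle h h' : h \in Hj -> h' \in Hj ->
    (`|X (h, h')| <= M)%N /\ (`|Y (h, h')| <= M)%N.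
  move=> /HjP[_ _ l1 _ _] /HjP[_ _ l2 _ _].
  have MM : M = ((2 * 2 ^ j) * (2 * 2 ^ j))%N by rewrite /M mulnACA -expnMn.
  rewrite MM /X /Y !abszM /=; split; apply: leq_mul; apply: ltnW;
    [apply: leq_ltn_trans l1|apply: leq_ltn_trans l2|apply: leq_ltn_trans l1|apply: leq_ltn_trans l2];
    by rewrite /sup_norm ?leq_maxl ?leq_maxr.
pose f (h : F * F) : F * ('I_(2 * M).+1 * 'I_(2 * M).+1) :=
  (h.1 * h.2, (inord `|X h + M%:Z|, inord `|Y h + M%:Z|)).
have fK : forall h h', h \in Hj -> h' \in Hj ->
    ((f (h, h')).2.1 : nat)%:Z - M%:Z = X (h, h') /\ ((f (h, h')).2.2 : nat)%:Z - M%:Z = Y (h, h').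
  move=> h h' hH h'H; have [] := normle h h' hH h'H; rewrite /f /=.
  move: (X _) (Y _) => x y hx hy.
  by rewrite !inordK; lia.
rewrite -mulnn -cardsX -card_dependent.
apply: (leq_card_fibers (f := f)) => [[h h']|[k u] ku].
  rewrite in_setX => /andP[hH h'H]; have [e1 e2] := fK h h' hH h'H.
  have [hG h0 _ x0 y0] := HjP h hH; have [h'G h'0 _ x'0 y'0] := HjP h' h'H.
  have [_ vh _] := hsv h; have [_ vh' _] := hsv h'.
  rewrite inE unity_rootsM //= inE e1 e2 xpair_eqE negb_and /X /Y /= mulf_neq0 //=.
  by rewrite !rmorphM /= vh vh'; apply/eqP; ring.
pose x0 : int := (u.1 : nat)%:Z - M%:Z; pose y0 : int := (u.2 : nat)%:Z - M%:Z.
set P := [set _ in _ | _].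
have [->|[[g g'] gP]] := set_0Vmem P; first by rewrite cards0.
have PP h h' : (h, h') \in P -> [/\ h \in Hj, h' \in Hj, h * h' = k, X (h, h') = x0 & Y (h, h') = y0].
  rewrite inE in_setX => /andP[/andP[hH h'H] /eqP e]; have [e1 e2] := fK h h' hH h'H.
  split => //; last 2 first.
  - by rewrite -e1 e.
  - by rewrite -e2 e.
  - by have := congr1 fst e.
have [xM yM] : (`|x0| <= M)%N /\ (`|y0| <= M)%N.
  have [gH g'H _ <- <-] := PP g g' gP; exact: normle.
have [xn0 yn0] : x0 != 0 /\ y0 != 0.
  have [/HjP[_ _ _ x1 y1] /HjP[_ _ _ x2 y2] _ <- <-] := PP g g' gP.
  by rewrite !mulf_neq0.
(* With the nonzero products x0 and y0 fixed, the coordinates of the first vector divide them up to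
   sign: 4 D^2 choices. That vector determines h, as its second coordinate is invertible in F, and
   then k determines h'. *)
pose Dv (m : nat) : {set 'I_M.+1} := [set d : 'I_M.+1 | (d %| m)%N].
have cDv m : (0 < m <= M)%N -> (#|Dv m| <= D)%N.
  move=> mM; apply: leq_trans (hD m mM).
  rewrite cardE -(size_map val); apply: uniq_leq_size.
    by rewrite map_inj_uniq ?enum_uniq //; exact: val_inj.
  move=> _ /mapP[d + ->]; rewrite mem_enum inE -dvdn_divisors //.
  by case/andP: mM.
pose E := finset.setX (finset.setX [set: bool] (Dv `|x0|%N)) (finset.setX [set: bool] (Dv `|y0|%N)).
have cE : (#|E| <= 4 * D ^ 2)%N.
  rewrite !cardsX cardsT card_bool -mulnn [(4 * _)%N](_ : _ = (2 * D) * (2 * D))%N; last by ring.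
  by rewrite leq_mul // leq_mul2l cDv ?orbT // absz_gt0 ?xM ?yM ?andbT.
apply: leq_trans cE.
pose phi (h : F * F) : (bool * 'I_M.+1) * (bool * 'I_M.+1) :=
  ((0 <= (sv h.1).1, inord `|(sv h.1).1|), (0 <= (sv h.1).2, inord `|(sv h.1).2|)).
have bnd h h' : (h, h') \in P -> (`|(sv h).1| <= M)%N /\ (`|(sv h).2| <= M)%N.
  move=> /PP[hH h'H _ _ _]; have [_ _ l1 _ _] := HjP h hH.
  have MM : (2 * 2 ^ j <= M)%N.
    by rewrite /M leq_mul // leq_exp2rW.
  split; apply: leq_trans MM; apply: ltnW; apply: leq_ltn_trans l1; rewrite /sup_norm ?leq_maxl ?leq_maxr //.
apply: (leq_card_inj (phi := phi)) => [[h h'] hP|[h h'] [g1 g1'] hP gP1].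
  have [l1 l2] := bnd h h' hP; have [_ _ _ ex ey] := PP h h' hP.
  by rewrite !in_setX !in_setT !inE /= !inordK ?ltnS // -ex -ey /X /Y !abszM !dvdn_mulr.
have [l1 l2] := bnd h h' hP; have [l1' l2'] := bnd g1 g1' gP1.
rewrite /phi /= => -[s1 /(congr1 val) a1 s2 /(congr1 val) a2].
move: a1 a2; rewrite /= !inordK ?ltnS // => a1 a2.
have e1 : (sv h).1 = (sv g1).1.
  by move: s1 a1; move: ((sv h).1) ((sv g1).1) => a b; case: (lerP 0 a) => ?; case: (lerP 0 b) => //; lia.
have e2 : (sv h).2 = (sv g1).2.
  by move: s2 a2; move: ((sv h).2) ((sv g1).2) => a b; case: (lerP 0 a) => ?; case: (lerP 0 b) => //; lia.
have [hH h'H hk _ _] := PP h h' hP; have [gH g'H gk _ _] := PP g1 g1' gP1.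
have [_ h0 _ _ y1] := HjP h hH; have [_ vh _] := hsv h; have [_ vg _] := hsv g1.
have yF : (sv h).2%:~R != 0 :> F.
  rewrite (intr_small_eq0 pF) //; apply: leq_ltn_trans (shortest_lt pF (hp h)); exact: leq_maxr.
have eh : h = g1 by apply: (mulIf yF); rewrite -vh e1 vg e2.
by move: hk; rewrite -gk -eh => /(mulfI h0) ->.
Qed.

Lemma sum_const_card (R : pzSemiRingType) (I : finType) (A : {set I}) (c : R) :
  \sum_(i in A) c = #|A|%:R * c.
Proof. by rewrite sumr_const mulr_natl. Qed.

(* Let sigma be the sum and x = P_j / 2^j the largest of the l dyadic
   contributions, P_j counting the h whose shortest vector has norm about 2^j.
   Then sigma <= l x, and short_vectors_square gives
   x^2 << D^2 (sigma + 4^j n / p); if the second term dominates, multiply by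
   x^2 <= n^2 / 4^j. *)
Lemma sum_inv_shortest (R : realFieldType) (F : finFieldType) p n
    (sv : F -> int * int) (D : nat) (B : R) :
  p \in [pchar F] -> (0 < n)%N -> #|unity_roots F n| = n ->
  (forall h, shortest h (sv h)) -> (forall h, (sup_norm (sv h) * sup_norm (sv h) <= p)%N) ->
  (0 < D)%N -> (forall m, (0 < m <= 4 * p)%N -> (size (divisors m) <= D)%N) ->
  0 <= B -> n%:R ^+ 3 / p%:R <= B ^+ 4 ->
  \sum_(h in unity_roots F n) (sup_norm (sv h))%:R^-1 <=
    64 * (trunc_log 2 p).+1%:R ^+ 2 * D%:R ^+ 2 * (1 + B).
Proof.
move=> pF n0 hG hsv hp D0 hD B0 hB; set G := unity_roots F n; set l := (trunc_log 2 p).+1.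
set sigma := \sum_(h in G) _.
have p0 := prime_gt0 (pcharf_prime pF).
have pR : 0 < p%:R :> R by rewrite ltr0n.
have nR : 0 < n%:R :> R by rewrite ltr0n.
have vg h : (0 < sup_norm (sv h))%N by have [v0 _ _] := hsv h; exact: sup_norm_gt0.
pose lev h := trunc_log 2 (sup_norm (sv h)).
have levl h : (lev h < l)%N.
  rewrite /l ltnS; apply: leq_trunc_log; apply: leq_trans (hp h).
  exact: leq_pmulr.
pose Hj j := [set h in G | lev h == j].
pose x (j : 'I_l) : R := #|Hj j|%:R / 2 ^+ j.
have sx : sigma <= \sum_j x j.
  rewrite /sigma (partition_big (fun h => Ordinal (levl h)) xpredT) //=.
  apply: ler_sum => j _; rewrite /x.
  apply: le_trans (_ : \sum_(h in Hj j) (2 ^+ j)^-1 <= _); last first.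
    by rewrite sum_const_card.
  rewrite (eq_bigl (fun h => h \in Hj j)) => [|h]; last by rewrite [RHS]inE.
  apply: ler_sum => h; rewrite inE => /andP[_ /eqP <-].
  rewrite lef_pV2 ?posrE ?ltr0n ?exprn_gt0 ?ltr0n // -natrX ler_nat.
  exact: trunc_logP.
have [j _ hj] := @arg_maxP _ _ _ (ord0 : 'I_l) xpredT x isT.
have slx : sigma <= l%:R * x j.
  apply: le_trans sx _; apply: le_trans (_ : \sum_(i < l) x j <= _).
    by apply: ler_sum => i _; exact: hj.
  by rewrite sumr_const card_ord mulr_natl.
have x0 : 0 <= x j by rewrite divr_ge0 ?ler0n ?exprn_ge0 ?ler0n.
have dR : 1 <= D%:R :> R by rewrite ler1n.
have lR : 1 <= l%:R :> R by rewrite ler1n.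
suff hx : x j <= 64 * D%:R ^+ 2 * l%:R * (1 + B).
  apply: le_trans slx _; apply: le_trans (_ : l%:R * (64 * D%:R ^+ 2 * l%:R * (1 + B)) <= _).
    by rewrite ler_wpM2l ?ler0n.
  by rewrite expr2; lra.
have [Hj0|[h hH]] := set_0Vmem (Hj j).
  rewrite /x Hj0 cards0 mul0r !mulr_ge0 ?ler0n ?exprn_ge0 ?addr_ge0 ?ler0n //.
(* A nonempty level forces 4^j <= p, so products of its vectors have coordinates at most 4 p, the
   range in which D bounds divisor counts. *)
have wp : (4 ^ j <= p)%N.
  move: hH; rewrite inE => /andP[_ /eqP hj'].
  apply: leq_trans (hp h); rewrite -[4%N]/(2 * 2)%N expnMn -hj'.
  by apply: leq_mul; exact: trunc_logP.
have := @short_vectors_square F p n sv j D pF n0 hsv hp.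
have hD' m : (0 < m <= 4 * 4 ^ j)%N -> (size (divisors m) <= D)%N.
  move=> /andP[m0 mj]; apply: hD; rewrite m0 /=; apply: leq_trans mj _.
  by rewrite leq_mul2l wp.
move=> /(_ hD'); rewrite -/(lev _) -/(Hj j) -(ler_nat R) natrX natrM natrM natrX natr_sum => sq.
set w : R := 4 ^+ j; have w0 : 0 < w by rewrite exprn_gt0 ?ltr0n.
have w2 : w = (2 ^+ j) ^+ 2 by rewrite /w -exprM mulnC exprM expr2 -natrM.
have PE : #|Hj j|%:R ^+ 2 = x j ^+ 2 * w.
  by rewrite /x w2; field; rewrite expf_neq0 // pnatr_eq0.
have sumc : \sum_(k in G) (#|lattice_box k (4 * 4 ^ j)|%:R : R) <= 8 * w * sigma + 512 * n%:R * w ^+ 2 / p%:R.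
  apply: le_trans (_ : \sum_(k in G) (8 * w * (sup_norm (sv k))%:R^-1 + 512 * w ^+ 2 / p%:R) <= _).
    apply: ler_sum => k _; apply: le_trans (card_lattice_box R _ pF (hp k) (hsv k)) _.
    rewrite natrM natrX -/w; rewrite le_eqVlt; apply/orP; left; apply/eqP; field.
    by rewrite !lt0r_neq0 // ltr0n.
  rewrite big_split /= -mulr_sumr sum_const_card hG lerD2l.
  by rewrite le_eqVlt; apply/orP; left; apply/eqP; field; rewrite lt0r_neq0.
have key : x j ^+ 2 <= 4 * D%:R ^+ 2 * (8 * sigma + 512 * n%:R * w / p%:R).
  rewrite -(ler_pM2r w0) -PE; apply: le_trans sq _.
  apply: le_trans (_ : 4 * D%:R ^+ 2 * (8 * w * sigma + 512 * n%:R * w ^+ 2 / p%:R) <= _).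
    by rewrite ler_wpM2l // mulr_ge0 ?ler0n ?exprn_ge0 ?ler0n.
  by rewrite le_eqVlt; apply/orP; left; apply/eqP; field; rewrite lt0r_neq0.
have xwn : x j ^+ 2 * w <= n%:R ^+ 2.
  rewrite -PE -!natrX ler_nat leq_exp2r // -[X in (_ <= X)%N]hG; apply: subset_leq_card.
  by apply/subsetP => z; rewrite inE => /andP[].
move: (x j) (D%:R : R) (l%:R : R) x0 dR lR key xwn slx => X d L X0 d1 L1 key xwn slx.
clearbody w sigma.
have d0 : 0 <= d := le_trans ler01 d1.
have L0 : 0 <= L := le_trans ler01 L1.
have dd : 0 <= d ^+ 2 by rewrite exprn_ge0.
have cd c : 0 <= c%:R * d ^+ 2 := mulr_ge0 (ler0n _ c) dd.
have [c1|c2] := lerP (512 * n%:R * w / p%:R) (8 * sigma).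
  have h1 : X ^+ 2 <= 64 * d ^+ 2 * L * X.
    apply: le_trans key _; apply: le_trans (_ : 4 * d ^+ 2 * (16 * (L * X)) <= _); last by lra.
    apply: (ler_wpM2l (cd 4%N)); lra.
  have [->|Xn0] := eqVneq X 0; first by rewrite !mulr_ge0 ?addr_ge0 ?ler0n.
  have Xg : 0 < X by rewrite lt_neqAle eq_sym Xn0.
  apply: le_trans (_ : 64 * d ^+ 2 * L <= _); first by rewrite -(ler_pM2r Xg) -expr2.
  by rewrite ler_peMr ?mulr_ge0 ?ler0n // lerDl.
have h1 : X ^+ 2 <= 4096 * d ^+ 2 * (n%:R * w / p%:R).
  apply: le_trans key _; apply: le_trans (_ : 4 * d ^+ 2 * (1024 * (n%:R * w / p%:R)) <= _); last by lra.
  apply: (ler_wpM2l (cd 4%N)); lra.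
have h2 : X ^+ 4 <= (8 * d * B) ^+ 4.
  apply: le_trans (_ : 4096 * d ^+ 2 * B ^+ 4 <= _); last first.
    have -> : (8 * d * B) ^+ 4 = 4096 * d ^+ 2 * B ^+ 4 * d ^+ 2 by ring.
    apply: ler_peMr; last exact: exprn_ege1.
    exact: mulr_ge0 (cd _) (exprn_ge0 _ B0).
  apply: le_trans (_ : 4096 * d ^+ 2 * (n%:R ^+ 3 / p%:R) <= _); last first.
    exact: ler_wpM2l (cd _) _ _ hB.
  have -> : X ^+ 4 = X ^+ 2 * X ^+ 2 by ring.
  apply: le_trans (_ : 4096 * d ^+ 2 * (n%:R * w / p%:R) * X ^+ 2 <= _).
    exact: ler_wpM2r (sqr_ge0 X) _ _ h1.
  apply: le_trans (_ : 4096 * d ^+ 2 * (n%:R / p%:R) * (X ^+ 2 * w) <= _).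
    by rewrite le_eqVlt; apply/orP; left; apply/eqP; field; rewrite lt0r_neq0.
  apply: le_trans (_ : 4096 * d ^+ 2 * (n%:R / p%:R) * n%:R ^+ 2 <= _).
    apply: ler_wpM2l xwn; apply: mulr_ge0 (cd _) _.
    exact: divr_ge0 (ler0n _ _) (ler0n _ _).
  by rewrite le_eqVlt; apply/orP; left; apply/eqP; field; rewrite lt0r_neq0.
have h3 : X <= 8 * d * B.
  by rewrite -(@ler_pXn2r _ 4) // nnegrE // !mulr_ge0 ?ler0n.
apply: le_trans h3 _.
have dB : d * B <= d ^+ 2 * L * (1 + B).
  have -> : d ^+ 2 * L * (1 + B) = d * (d * L * (1 + B)) by ring.
  rewrite ler_wpM2l //; have dL : 1 <= d * L by rewrite mulr_ege1.
  apply: le_trans (_ : 1 * (1 + B) <= _); first by rewrite mul1r lerDr ler01.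
  by rewrite ler_wpM2r // addr_ge0.
have := mulr_ge0 d0 B0; lra.
Qed.

(** Sorting the collisions by x and h = y / x leaves pairs with m = h m' in F. Differences of such
    pairs lie in the lattice of h, so the shift L disappears. *)
Lemma multiplicative_collisions (R : realFieldType) (F : finFieldType) p n
    (sv : F -> int * int) (L : int) (N : nat) :
  p \in [pchar F] -> (0 < n)%N -> #|unity_roots F n| = n ->
  (forall h, shortest h (sv h)) -> (forall h, (sup_norm (sv h) * sup_norm (sv h) <= p)%N) ->
  (coll (finset.setX [set: 'I_N] (unity_roots F n))
    (fun z => (L + (z.1 : nat).+1%:Z)%:~R * z.2))%:R <=
  n%:R * (n%:R + N%:R * (\sum_(h in unity_roots F n) (sup_norm (sv h))%:R^-1) +
    8 * N%:R ^+ 2 * n%:R / p%:R) :> R.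
Proof.
move=> pF n0 hG hsv hp; set G := unity_roots F n.
have p0 := prime_gt0 (pcharf_prime pF).
have pR : 0 < p%:R :> R by rewrite ltr0n.
case: N => [|M].
  rewrite [X in X%:R <= _](_ : _ = 0%N); last first.
    by apply/eqP; rewrite cards_eq0; apply/eqP/setP => -[[[i ?] ?] ?].
  by rewrite mul0r !mulr_ge0 ?addr_ge0 ?mulr_ge0 ?invr_ge0 ?ler0n ?exprn_ge0 ?ler0n.
pose f (i : 'I_M.+1) : F := (L + (i : nat).+1%:Z)%:~R.
pose T (h : F) := [set ij : 'I_M.+1 * 'I_M.+1 | f ij.1 == h * f ij.2].
pose S := finset.setX G [set z : F * ('I_M.+1 * 'I_M.+1) | (z.1 \in G) && (z.2 \in T z.1)].
apply: le_trans (_ : #|S|%:R <= _).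
  rewrite ler_nat; pose phi (z : ('I_M.+1 * F) * ('I_M.+1 * F)) := (z.1.2, (z.2.2 / z.1.2, (z.1.1, z.2.1))).
  apply: (leq_coll_inj (phi := phi)) => [[i x] [j y]|[i x] [j y] [i' x'] [j' y']]; rewrite !in_setX !in_setT /=.
    move=> xG yG e; have x0 := unity_roots_neq0 n0 xG.
    rewrite xG /= inE /= unity_rootsD //= inE /=; apply/eqP.
    by apply: (mulIf x0); rewrite e; field.
  move=> xG yG x'G y'G _ _ [] ex ey ei ej; subst x' i' j'.
  have x0 : x^-1 != 0 by rewrite invr_eq0 (unity_roots_neq0 n0 xG).
  by rewrite (mulIf x0 ey).
rewrite cardsX card_dependent hG natrM ler_wpM2l ?ler0n // natr_sum.
apply: le_trans (_ : \sum_(h in G) (1 + M.+1%:R * (sup_norm (sv h))%:R^-1 + 8 * M.+1%:R ^+ 2 / p%:R) <= _).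
  apply: ler_sum => h _; apply: le_trans (card_box_real R pF (hp h) (hsv h) _) _.
    move=> u w; rewrite !inE => /eqP hu /eqP hw.
    have -> : (u.1 : nat)%:Z - (w.1 : nat)%:Z = (L + (u.1 : nat).+1%:Z) - (L + (w.1 : nat).+1%:Z) by lia.
    have -> : (u.2 : nat)%:Z - (w.2 : nat)%:Z = (L + (u.2 : nat).+1%:Z) - (L + (w.2 : nat).+1%:Z) by lia.
    by rewrite !rmorphB /= -/(f _) -/(f _) hu hw -/(f _) -/(f _) mulrBr.
  have MM : M%:R <= M.+1%:R :> R by rewrite ler_nat.
  rewrite -!addrA lerD2l lerD //; first by rewrite ler_wpM2r ?invr_ge0 ?ler0n.
  rewrite ler_wpM2r ?invr_ge0 ?ler0n // ler_wpM2l ?ler0n // lerXn2r ?nnegrE ?ler0n //.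
rewrite !big_split /= !sum_const_card hG -mulr_sumr mulr1 lerD2l.
by rewrite le_eqVlt; apply/orP; left; apply/eqP; field; rewrite lt0r_neq0.
Qed.

Local Open Scope complex_scope.

(** * Exponential sums *)

Lemma sqr_normcE (R : realType) (z : R[i]) : (Normc.normc z ^+ 2)%:C = z * z^*%C.
Proof.
case: z => a b; rewrite /Normc.normc sqr_sqrtr ?addr_ge0 ?sqr_ge0 //.
by apply/eqP; rewrite eq_complex /=; apply/andP; split; apply/eqP; ring.
Qed.

Lemma epE (R : realType) (p : nat) (b : int) :
  ep R p b = cos (2 * pi * b%:~R / p%:R) +i* sin (2 * pi * b%:~R / p%:R).
Proof.
rewrite /ep.
have -> : 2 * (pi : R)%:C * 'i%C * b%:~R / p%:R = 0 +i* (2 * pi * b%:~R / p%:R).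
  have -> : 0 +i* (2 * pi * b%:~R / p%:R) = (2 * pi * b%:~R / p%:R)%:C * 'i%C :> R[i].
    by apply/eqP; rewrite eq_complex /=; apply/andP; split; apply/eqP; ring.
  rewrite !rmorphM /= fmorphV !rmorph_nat rmorph_int /=; ring.
rewrite /cexp /= expR0; apply/eqP; rewrite eq_complex /=.
by apply/andP; split; apply/eqP; ring.
Qed.

Lemma epD (R : realType) (p : nat) (b c : int) : ep R p (b + c) = ep R p b * ep R p c.
Proof.
rewrite !epE rmorphD /= mulrDr mulrDl cosD sinD.
by apply/eqP; rewrite eq_complex /=; apply/andP; split; apply/eqP; ring.
Qed.

Lemma ep0 (R : realType) (p : nat) : ep R p 0 = 1.
Proof. by rewrite epE /= mulr0 mul0r cos0 sin0. Qed.

Lemma epN_conj (R : realType) (p : nat) (b : int) : ep R p (- b) = (ep R p b)^*%C.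
Proof. by rewrite !epE rmorphN /= mulrN mulNr cosN sinN. Qed.

Lemma ep_mul (R : realType) (p : nat) (k : int) : (0 < p)%N -> ep R p (p%:Z * k) = 1.
Proof.
move=> p0; have pR : p%:R != 0 :> R by rewrite pnatr_eq0 -lt0n.
have h (m : nat) : ep R p (p%:Z * m%:Z) = 1.
  elim: m => [|m IH]; first by rewrite mulr0 ep0.
  rewrite -addn1 PoszD mulrDr epD IH mulr1 mul1r epE.
  by rewrite mulfK // mulr_natl cos2pi sin2pi.
case: k => m; first exact: h.
have := epD R p (p%:Z * m.+1%:Z) (p%:Z * Negz m).
by rewrite h mul1r NegzE mulrN subrr ep0 => <-.
Qed.

Lemma ep1_neq1 (R : realType) (p : nat) : (1 < p)%N -> ep R p 1 != 1.
Proof.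
move=> p1; have pR : 0 < p%:R :> R by rewrite ltr0n ltnW.
rewrite epE mulr1 -mulrA mulr_natl.
have pr : pi / p%:R < pi :> R.
  by rewrite ltr_pdivrMr // ltr_pMr ?pi_gt0 // ltr1n.
have s0 : 0 < sin (pi / p%:R :> R).
  by apply: sin_gt0_pi; rewrite divr_gt0 ?pi_gt0.
(* By the doubling formula, a cosine equal to 1 at 2 pi / p would force sin (pi / p) = 0, but 0 < pi
   / p < pi. *)
apply/negP => /eqP [+ _]; rewrite cos_mulr2n => h.
have := cos2Dsin2 (pi / p%:R : R); have := exprn_gt0 2 s0; lra.
Qed.

Definition echar (R : realType) (p : nat) (u : 'F_p) : R[i] := ep R p (u : nat)%:Z.

Lemma ep_mod (R : realType) (p : nat) (b c : int) : prime p ->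
  (b%:~R = c%:~R :> 'F_p) -> ep R p b = ep R p c.
Proof.
move=> pp bc; have p0 := prime_gt0 pp.
have pF : p \in [pchar 'F_p] by exact: pchar_Fp.
have : (p %| `|b - c|)%N by rewrite -(intr_pchar_eq0 _ pF) rmorphB /= bc subrr.
rewrite -[p]/(`|p%:Z|)%N -dvdzE => /dvdzP[k e].
have -> : b = c + p%:Z * k by rewrite mulrC -e addrCA subrr addr0.
by rewrite epD ep_mul ?mulr1.
Qed.

Lemma ep_echar (R : realType) (p : nat) (b : int) : prime p -> ep R p b = echar R (b%:~R : 'F_p).
Proof.
move=> pp; apply: ep_mod => //; rewrite -pmulrn; exact/esym/natr_Zp.
Qed.

Lemma echarD (R : realType) (p : nat) (u v : 'F_p) : prime p ->
  echar R (u + v) = echar R u * echar R v.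
Proof.
move=> pp; rewrite -epD; apply: ep_mod => //.
by rewrite intrD -!pmulrn !natr_Zp.
Qed.

Lemma echar0 (R : realType) (p : nat) : echar R (0 : 'F_p) = 1.
Proof. by rewrite /echar ep0. Qed.

Lemma echarN (R : realType) (p : nat) (u : 'F_p) : prime p -> echar R (- u) = (echar R u)^*%C.
Proof.
move=> pp; rewrite -epN_conj; apply: ep_mod => //.
by rewrite mulrNz -!pmulrn !natr_Zp.
Qed.

Lemma sum_echar (R : realType) (p : nat) (s : 'F_p) : prime p ->
  \sum_(u : 'F_p) echar R (u * s) = if s == 0 then p%:R else 0.
Proof.
move=> pp; case: eqP => [->|/eqP s0].
  rewrite (eq_bigr (fun=> 1)) => [|u _]; last by rewrite mulr0 echar0.
  by rewrite sumr_const card_Fp.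
rewrite -(reindex_inj (h := fun u => u * s) (P := xpredT) (F := fun u => echar R u)) /=; last exact: mulIf.
set T := \sum_u _; have e1 : echar R (1 : 'F_p) != 1.
  by have := ep1_neq1 R (prime_gt1 pp); rewrite ep_echar // mulr1z.
have : (echar R (1 : 'F_p) - 1) * T = 0.
  rewrite mulrBl mul1r {2}/T (reindex_inj (addrI 1)) /= mulr_sumr -sumrB.
  by apply: big1 => u _; rewrite echarD // subrr.
by move=> /eqP; rewrite mulf_eq0 subr_eq0 (negPf e1) => /eqP.
Qed.

(** Orthogonality of the characters. With f the sum of the coordinates on G^2 or G^3 it yields the
    fourth and sixth moments. *)
Lemma parseval (R : realType) (p : nat) (I : finType) (P : {set I}) (f : I -> 'F_p) : prime p ->
  \sum_(u : 'F_p) Normc.normc (\sum_(i in P) echar R (u * f i)) ^+ 2 = p%:R * (coll P f)%:R.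
Proof.
move=> pp; apply: (@complexI R); rewrite rmorph_sum rmorphM /= !rmorph_nat.
transitivity (\sum_(u : 'F_p) \sum_(i in P) \sum_(j in P) echar R (u * (f i - f j))).
  apply: eq_bigr => u _; rewrite sqr_normcE rmorph_sum mulr_suml; apply: eq_bigr => i _.
  rewrite mulr_sumr; apply: eq_bigr => j _.
  by rewrite -[X in _ * X]/((echar R (u * f j))^*%C) -echarN // -echarD // mulrBr.
rewrite exchange_big /=; transitivity (\sum_(i in P) \sum_(j in P) (if f i - f j == 0 then p%:R else 0) : R[i]).
  apply: eq_bigr => i _; rewrite exchange_big /=; apply: eq_bigr => j _.
  exact: sum_echar.
rewrite pair_big_dep /= -big_mkcondr /= sumr_const [RHS]mulr_natr; congr (_ *+ _).
by apply: eq_card => -[i j]; rewrite [RHS]inE unfold_in /= subr_eq0 andbA.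
Qed.

Lemma unity_roots_subgroup (p : nat) (H : {group {unit 'F_p}}) :
  unity_roots 'F_p #|H| = [set FinRing.uval x | x in H].
Proof.
have inj : injective (@FinRing.uval 'F_p) by exact: val_inj.
apply/esym/eqP; rewrite eqEcard; apply/andP; split.
  apply/subsetP => _ /imsetP[x xH ->]; rewrite inE.
  by rewrite -FinRing.val_unitX expg_cardG.
rewrite card_imset //; apply: card_nth_root; exact: cardG_gt0.
Qed.

Lemma card_unity_roots_subgroup (p : nat) (H : {group {unit 'F_p}}) :
  #|unity_roots 'F_p #|H| | = #|H|.
Proof. by rewrite unity_roots_subgroup card_imset //; exact: val_inj. Qed.

Lemma big_setX (V : nmodType) (I J : finType) (A : {set I}) (B : {set J}) (f : I * J -> V) :
  \sum_(z in finset.setX A B) f z = \sum_(x in A) \sum_(y in B) f (x, y).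
Proof.
by rewrite pair_big_dep; apply: eq_big => [[x y]|[x y] _] //; rewrite in_setX.
Qed.

Lemma sum_cube (V : pzSemiRingType) (I : finType) (A : {set I}) (f : I -> V) :
  (\sum_(x in A) f x) * (\sum_(x in A) f x) * (\sum_(x in A) f x) =
  \sum_(x in A) \sum_(y in A) \sum_(z in A) f x * f y * f z.
Proof.
rewrite !mulr_suml; apply: eq_bigr => x _; rewrite [f x * _]mulr_sumr mulr_suml.
by apply: eq_bigr => y _; rewrite mulr_sumr.
Qed.

Definition gauss_norm (R : realType) (p n : nat) (u : 'F_p) : R :=
  Normc.normc (\sum_(x in unity_roots 'F_p n) echar R (u * x)).

Lemma subgroup_sumE (R : realType) (p : nat) (H : {group {unit 'F_p}}) (b : int) :
  prime p -> subgroup_sum R H b = gauss_norm R #|H| (b%:~R : 'F_p).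
Proof.
move=> pp; rewrite /subgroup_sum /gauss_norm unity_roots_subgroup.
congr Normc.normc; rewrite big_imset /=; last by move=> x y _ _; exact: val_inj.
apply: eq_bigr => x _; rewrite ep_echar // intrM; congr (echar R (_ * _)).
by rewrite -pmulrn natr_Zp.
Qed.

Lemma gauss_norm_ge0 (R : realType) (p n : nat) (u : 'F_p) : 0 <= gauss_norm R n u.
Proof. by rewrite /gauss_norm; case: (\sum_(_ in _) _) => a b; exact: sqrtr_ge0. Qed.

Lemma gauss_norm_mul (R : realType) (p n : nat) (u h : 'F_p) : (0 < n)%N ->
  h \in unity_roots 'F_p n -> gauss_norm R n (u * h) = gauss_norm R n u.
Proof.
move=> n0 hG; congr Normc.normc; have h0 := unity_roots_neq0 n0 hG.
rewrite [RHS](reindex_inj (mulfI h0)) /=; apply: eq_big => [x|x _]; last by rewrite mulrA.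
by move: hG; rewrite !inE exprMn => /eqP ->; rewrite mul1r.
Qed.

Lemma sum_gauss_norm4 (R : realType) (p n : nat) : prime p ->
  \sum_(u : 'F_p) gauss_norm R n u ^+ 4 = p%:R * (energy2 (unity_roots 'F_p n))%:R.
Proof.
move=> pp; rewrite -parseval //; apply: eq_bigr => u _.
rewrite -[4%N]/(2 * 2)%N exprM; congr (_ ^+ 2).
rewrite /gauss_norm expr2 -Normc.normcM big_distrl /=; congr Normc.normc.
rewrite big_setX /=; apply: eq_bigr => x _; rewrite big_distrr /=.
by apply: eq_bigr => y _; rewrite mulrDr echarD.
Qed.

Lemma sum_gauss_norm6 (R : realType) (p n : nat) : prime p ->
  \sum_(u : 'F_p) gauss_norm R n u ^+ 6 = p%:R * (energy3 (unity_roots 'F_p n))%:R.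
Proof.
move=> pp; rewrite -parseval //; apply: eq_bigr => u _.
rewrite -[6%N]/(3 * 2)%N exprM; congr (_ ^+ 2).
rewrite /gauss_norm -[3%N]/(1 + 1 + 1)%N !exprD expr1 -!Normc.normcM; congr Normc.normc.
by rewrite sum_cube !big_setX; do 3!apply: eq_bigr => ? _; rewrite !mulrDr !echarD.
Qed.

(** * Hoelder's inequality for the weighted sum *)

Lemma sum_fibers (R : pzSemiRingType) (I K : finType) (P : {set I}) (f : I -> K) (A : K -> R) :
  \sum_(i in P) A (f i) = \sum_k #|[set i in P | f i == k]|%:R * A k.
Proof.
rewrite (partition_big f xpredT) //=; apply: eq_bigr => k _.
rewrite -sum_const_card; apply: eq_big => [i|i /andP[_ /eqP ->]] //.
by rewrite inE.
Qed.

Section Moments.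
Variables (R : realDomainType) (I K : finType) (P : {set I}) (f : I -> K) (A : K -> R).
Hypothesis A0 : forall k, 0 <= A k.
Let J k : R := #|[set i in P | f i == k]|%:R.

Let J0 k : 0 <= J k. Proof. exact: ler0n. Qed.

Let sumJ : \sum_k J k = #|P|%:R.
Proof.
have := sum_fibers P f (fun=> 1 : R); rewrite sum_const_card mulr1 => ->.
by apply: eq_bigr => k _; rewrite mulr1.
Qed.

Let sumJ2 : \sum_k J k ^+ 2 = (coll P f)%:R.
Proof. by rewrite collE natr_sum; apply: eq_bigr => k _; rewrite natrX. Qed.

Let mom m : \sum_k J k * A k ^+ m = \sum_(i in P) A (f i) ^+ m.
Proof. by rewrite (sum_fibers P f (fun k => A k ^+ m)). Qed.

Let cs1 : (\sum_(i in P) A (f i)) ^+ 2 <= #|P|%:R * \sum_(i in P) A (f i) ^+ 2.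
Proof.
rewrite -mom -sumJ (sum_fibers P f A); apply: cauchy_schwarz => k _ //.
  by rewrite mulr_ge0 ?exprn_ge0.
by rewrite exprMn expr2 mulrA.
Qed.

Let csJ m : (\sum_(i in P) A (f i) ^+ m) ^+ 2 <= (coll P f)%:R * \sum_k A k ^+ (2 * m).
Proof.
rewrite -mom -sumJ2; apply: cauchy_schwarz => k _; rewrite ?exprn_ge0 //.
by rewrite exprMn -exprM mulnC.
Qed.

Lemma fourth_moment : (\sum_(i in P) A (f i)) ^+ 4 <=
  #|P|%:R ^+ 2 * ((coll P f)%:R * \sum_k A k ^+ 4).
Proof.
rewrite [X in X <= _](exprM _ 2 2).
apply: le_trans (_ : (#|P|%:R * \sum_(i in P) A (f i) ^+ 2) ^+ 2 <= _).
  apply: lerXn2r cs1; rewrite nnegrE ?sqr_ge0 //.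
  by rewrite mulr_ge0 ?ler0n // sumr_ge0 // => i _; rewrite sqr_ge0.
by rewrite exprMn; apply: ler_wpM2l (csJ 2); rewrite sqr_ge0.
Qed.

(** Let X, Y, W be the sums of A, A^2, A^3 over P. Then X^2 <= |P| Y, Y^2 <= X W, and W^2 is at most
    the collision number times the sixth moment. So X^8 <= |P|^4 Y^4 <= |P|^4 X^2 W^2, and X^2
    cancels. *)
Lemma sixth_moment : (\sum_(i in P) A (f i)) ^+ 6 <=
  #|P|%:R ^+ 4 * ((coll P f)%:R * \sum_k A k ^+ 6).
Proof.
have := cs1.
have : (\sum_(i in P) A (f i) ^+ 3) ^+ 2 <= (coll P f)%:R * \sum_k A k ^+ 6 := csJ 3.
have : (\sum_(i in P) A (f i) ^+ 2) ^+ 2 <= (\sum_(i in P) A (f i)) * \sum_(i in P) A (f i) ^+ 3.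
  apply: cauchy_schwarz => i _; rewrite ?exprn_ge0 // le_eqVlt; apply/orP; left; apply/eqP.
  by rewrite -exprM -exprS.
have : 0 <= \sum_(i in P) A (f i) by apply: sumr_ge0.
have : 0 <= \sum_(i in P) A (f i) ^+ 2 by apply: sumr_ge0 => i _; rewrite sqr_ge0.
have : 0 <= \sum_k A k ^+ 6 by apply: sumr_ge0 => i _; rewrite exprn_ge0.
have : 0 <= (coll P f)%:R :> R by exact: ler0n.
have : 0 <= #|P|%:R :> R by exact: ler0n.
move: (\sum_(i in P) A (f i)) (\sum_(i in P) A (f i) ^+ 2) (\sum_(i in P) A (f i) ^+ 3)
  (\sum_k A k ^+ 6) (#|P|%:R : R) ((coll P f)%:R : R) => X Y W Z m c m0 c0 Z0 Y0 X0 YW WZ XY.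
have [->|Xn0] := eqVneq X 0; first by rewrite expr0n /= mulr_ge0 ?exprn_ge0 ?mulr_ge0.
have X2 : 0 < X ^+ 2 by rewrite exprn_gt0 // lt_neqAle eq_sym Xn0.
apply: le_trans (_ : m ^+ 4 * W ^+ 2 <= _); last by apply: ler_wpM2l WZ; rewrite exprn_ge0.
rewrite -(ler_pM2r X2) -exprD.
rewrite [X in X <= _](exprM _ 2 4); apply: le_trans (_ : (m * Y) ^+ 4 <= _).
  by apply: lerXn2r XY; rewrite nnegrE ?mulr_ge0 ?sqr_ge0.
rewrite exprMn -[leRHS]mulrA; apply: ler_wpM2l; first by rewrite exprn_ge0.
rewrite -exprMn [W * X]mulrC [leLHS](exprM _ 2 2).
have XW0 : 0 <= X * W := le_trans (sqr_ge0 _) YW.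
by apply: lerXn2r YW; rewrite nnegrE ?sqr_ge0.
Qed.
End Moments.

(** * Assembly of the bound *)

Lemma coll_mulf (F : finFieldType) (I : finType) (P : {set I}) (a : F) (f : I -> F) :
  a != 0 -> coll P (fun i => a * f i) = coll P f.
Proof.
move=> a0; apply: eq_card => ij; rewrite !inE; congr [&& _, _ & _].
exact: (inj_eq (mulfI a0)).
Qed.

Lemma interval_sumE (R : realType) (p : nat) (H : {group {unit 'F_p}}) (L : int) (N : nat) (a : int) :
  prime p -> (0 < #|H|)%N ->
  #|H|%:R * \sum_(n <- int_interval L N) subgroup_sum R H (a * n) =
  \sum_(z in finset.setX [set: 'I_N] (unity_roots 'F_p #|H|))
    gauss_norm R #|H| (a%:~R * ((L + (z.1 : nat).+1%:Z)%:~R * z.2)).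
Proof.
move=> pp H0; rewrite big_setX /=.
transitivity (\sum_(i < N) #|H|%:R * subgroup_sum R H (a * (L + (i : nat).+1%:Z))).
  rewrite -mulr_sumr; congr (_ * _); rewrite /int_interval big_map.
  rewrite -[1%N]addn0 iotaDl big_map.
  rewrite (_ : iota 0 N = index_iota 0 N) ?big_mkord; last by rewrite /index_iota subn0.
  by apply: eq_bigr => i _; rewrite add1n.
apply: eq_big => [i|i _]; first by rewrite inE.
rewrite -{1}card_unity_roots_subgroup -sum_const_card; apply: eq_bigr => x xG.
by rewrite subgroup_sumE // intrM mulrA [RHS]gauss_norm_mul.
Qed.

Lemma le_natr_powR (R : realType) (x k C p : nat) (d : R) :
  (0 < k)%N -> (0 < C)%N -> (0 < p)%N -> (x ^ k <= C * p)%N -> k%:R^-1 <= d ->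
  x%:R <= C%:R * (p%:R : R) `^ d.
Proof.
move=> k0 C0 p0 h kd; have kR : 0 < k%:R :> R by rewrite ltr0n.
have p1 : 1 <= p%:R :> R by rewrite ler1n.
rewrite -(@ler_pXn2r _ k) ?nnegrE ?mulr_ge0 ?powR_ge0 ?ler0n // exprMn.
apply: le_trans (_ : C%:R * p%:R <= _); first by rewrite -natrX -natrM ler_nat.
apply: ler_pM; rewrite ?ler0n //; first by rewrite -natrX ler_nat -{1}[C]expn1 leq_pexp2l.
rewrite -powR_mulrn ?powR_ge0 // -powRrM -{1}[p%:R]powRr1 ?ler0n //.
apply: ler_powR => //; rewrite -[leLHS](mulVf (lt0r_neq0 kR)).
by rewrite ler_pM2r.
Qed.

Lemma le_mul_powR (R : realType) (k : nat) (S T D : R) :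
  (0 < k)%N -> 0 <= S -> 0 <= T -> 0 <= D -> S ^+ k <= T ^+ k * D ->
  S <= T * D `^ (1 / k%:R).
Proof.
move=> k0 S0 T0 D0 h.
rewrite -(@ler_pXn2r _ k) ?nnegrE ?mulr_ge0 ?powR_ge0 // exprMn.
rewrite -[_ `^ _ ^+ k]powR_mulrn ?powR_ge0 // -powRrM mul1r mulVf ?powRr1 //.
by rewrite pnatr_eq0 -lt0n.
Qed.

Lemma energy_bounds (R : realType) : exists2 C : nat, (0 < C)%N &
  forall p n, prime p -> (0 < n)%N -> (n * n < p)%N -> #|unity_roots 'F_p n| = n ->
    (energy2 (unity_roots 'F_p n))%:R <=
      C%:R * (trunc_log 2 p).+1%:R * n%:R `^ (49 / 20) :> R /\
    (energy3 (unity_roots 'F_p n))%:R <= C%:R * (trunc_log 2 p).+1%:R * n%:R ^+ 4 :> R.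
Proof.
have [C0 hC0] := sum_fiber_cube; pose C := C0.+1; exists (512 * C)%N => // p n pp n0 np hG.
pose M := (C * (n * n) * (trunc_log 2 p).+1)%N; set l := (trunc_log 2 p).+1 in M *.
have nM : (n * n <= M)%N by rewrite /M -mulnA mulnCA leq_pmulr.
have hM (Th : {set 'F_p * 'F_p}) : (#|Th| <= n * n)%N -> (\sum_(th in Th) fiber n th ^ 3 <= M)%N.
  move=> hTh; apply: leq_trans (hC0 _ p n Th (pchar_Fp pp) np hTh) _.
  apply: leq_mul; first by rewrite leq_mul2r leqnSn orbT.
  rewrite ltnS; apply: leq_trunc_log; apply: leq_trans (ltnW np); exact: leq_pmulr.
split; last first.
  have h := energy3_bound n0 hG nM hM; rewrite -natrX -!natrM ler_nat.
  apply: leq_trans h _.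
  have -> : (5 * (n * n) * M = 5 * (C * l * n ^ 4))%N by rewrite /M; ring.
  have -> : (512 * C * l * n ^ 4 = 512 * (C * l * n ^ 4))%N by ring.
  exact: leq_mul.
have h := energy2_bound n0 hG nM hM.
rewrite -(@ler_pXn2r _ 9) ?nnegrE ?mulr_ge0 ?powR_ge0 ?ler0n //.
apply: le_trans (_ : (512 * n ^ 12 * M ^ 5)%N%:R <= _); first by rewrite -natrX ler_nat.
have -> : (512 * n ^ 12 * M ^ 5 = 512 * (C * l) ^ 5 * n ^ 22)%N by rewrite /M; ring.
rewrite exprMn -natrM -natrX natrM; apply: ler_pM; rewrite ?ler0n //.
  rewrite ler_nat -mulnA [X in (_ <= X)%N]expnMn; apply: leq_mul; first exact: (@leq_pexp2l 512 1 9).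
  by rewrite leq_pexp2l // muln_gt0.
have n1 : 1 <= n%:R :> R by rewrite ler1n.
rewrite natrX -[leLHS]powR_mulrn ?ler0n // -[leRHS]powR_mulrn ?powR_ge0 // -powRrM.
by apply: ler_powR => //; lra.
Qed.

Lemma collisions_Gamma (R : realType) (p n N D : nat) (L : int) :
  prime p -> (0 < n)%N -> #|unity_roots 'F_p n| = n -> (0 < N)%N -> (0 < D)%N ->
  (forall m, (0 < m <= 4 * p)%N -> (size (divisors m) <= D)%N) ->
  (coll (finset.setX [set: 'I_N] (unity_roots 'F_p n))
    (fun z => (L + (z.1 : nat).+1%:Z)%:~R * z.2))%:R <=
  64 * (trunc_log 2 p).+1%:R ^+ 2 * D%:R ^+ 2 * (n%:R * N%:R) * Gamma R p N n.
Proof.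
move=> pp n0 hG N0 D0 hD; have pF : p \in [pchar 'F_p] by exact: pchar_Fp.
have [sv hsv] := fin_all_exists (fun h : 'F_p =>
  let: ex_intro2 v hv hp := exists_shortest h pF (card_Fp pp) in
  ex_intro (fun v => shortest h v /\ (sup_norm v * sup_norm v <= p)%N) v (conj hv hp)).
have hs h := (hsv h).1; have hp h := (hsv h).2.
have p0 := prime_gt0 pp.
have pR : 0 < p%:R :> R by rewrite ltr0n.
have NR : 0 < N%:R :> R by rewrite ltr0n.
(* The choice B^4 = n^3 / p meets the hypothesis of [sum_inv_shortest] and is the origin of the last
   term of Gamma. The term n / N comes from the single point that every box may contain, N n / p
   from the area of the boxes. *)
pose B : R := n%:R `^ (3 / 4) / p%:R `^ (1 / 4).
have B0 : 0 <= B by rewrite divr_ge0 ?powR_ge0.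
have hB : n%:R ^+ 3 / p%:R <= B ^+ 4.
  rewrite exprMn exprVn -![_ `^ _ ^+ 4]powR_mulrn ?powR_ge0 // -!powRrM.
  have -> : 3 / 4 * 4%:R = 3%:R :> R by field.
  have -> : 1 / 4 * 4%:R = 1 :> R by field.
  by rewrite powRr1 ?ler0n // powR_mulrn ?ler0n.
have sg := sum_inv_shortest pF n0 hG hs hp D0 hD B0 hB.
apply: le_trans (multiplicative_collisions R L N pF n0 hG hs hp) _.
have l1 : 1 <= (trunc_log 2 p).+1%:R ^+ 2 * D%:R ^+ 2 :> R.
  by rewrite -!natrX -natrM ler1n muln_gt0 !expn_gt0 D0.
move: sg; rewrite -![64 * _ * D%:R ^+ 2]mulrA.
move: (_ ^+ 2 * _) l1 => W W1; move: (\sum_(h in _) _) => sg hsg.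
rewrite /Gamma -/B.
have -> : 64 * W * (n%:R * N%:R) * (1 + n%:R / N%:R + N%:R * n%:R / p%:R + B) =
   n%:R * (64 * W * n%:R + N%:R * (64 * W * (1 + B)) + 64 * W * (N%:R ^+ 2 * n%:R / p%:R)).
  by field; rewrite !lt0r_neq0.
apply: ler_wpM2l; rewrite ?ler0n //; apply: lerD; last first.
  have -> : 8 * N%:R ^+ 2 * n%:R / p%:R = 8 * (N%:R ^+ 2 * n%:R / p%:R) :> R by rewrite !mulrA.
  apply: ler_wpM2r; last by lra.
  exact: divr_ge0 (mulr_ge0 (sqr_ge0 _) (ler0n _ _)) (ltW pR).
apply: lerD; last exact: ler_wpM2l (ltW NR) _ _ hsg.
rewrite -[leLHS]mul1r; apply: ler_wpM2r; rewrite ?ler0n //; lra.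
Qed.

Lemma max_divisors_bound k C : (forall m, (0 < m)%N -> (size (divisors m) ^ k <= C * m)%N) ->
  forall p, (0 < p)%N -> exists D, [/\ (0 < D)%N, (D ^ k <= 4 * C * p)%N &
    forall m, (0 < m <= 4 * p)%N -> (size (divisors m) <= D)%N].
Proof.
move=> hC p p0; pose s (m : 'I_(4 * p)) := size (divisors m.+1).
have h1 : (0 < 4 * p)%N by rewrite muln_gt0.
exists (\max_m s m)%N; split.
- have := bigop.leq_bigmax (F := s) (Ordinal h1); apply: leq_trans.
  by rewrite /s; case: divisors (divisor1 1).
- have [i ->] : {i | (\max_m s m)%N = s i} by apply: bigop.eq_bigmax; rewrite card_ord.
  apply: leq_trans (hC _ _) _ => //; rewrite -mulnA mulnCA leq_mul2l; apply/orP; right.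
  exact: ltn_ord.
move=> [//|m] /= m4; exact: (bigop.leq_bigmax (F := s) (Ordinal m4)).
Qed.

Section MomentsToBound.
Variables (R : realFieldType) (S N n p J E G W V q c P : R).
Hypotheses (N0 : 0 < N) (n0 : 0 < n) (p0 : 0 < p) (q0 : 0 < q)
  (J0 : 0 <= J) (E0 : 0 <= E) (G0 : 0 <= G) (c1 : 1 <= c) (P0 : 0 <= P)
  (hJ : J <= W * (n * N) * G).

(** [q] will be n^(2 + 11/20), so that n^5 / q is n^(49/20). Because c >= 1, the constant may be
    moved inside the fourth power. *)
Lemma fourth_moment_bound : W * V <= c * P ^+ 4 -> E <= V * (n ^+ 5 / q) ->
  (n * S) ^+ 4 <= (N * n) ^+ 2 * (J * (p * E)) ->
  S ^+ 4 <= (c * P * (N * n)) ^+ 4 * (p / (N * q) * G).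
Proof.
move=> WV hE h; have n4 : 0 < n ^+ 4 by rewrite exprn_gt0.
have Nn0 : 0 <= n * N by rewrite mulr_ge0 ?ltW.
rewrite -(ler_pM2l n4) -exprMn; apply: le_trans h _.
have nq : 0 <= n ^+ 5 / q by rewrite divr_ge0 ?exprn_ge0 ?ltW.
apply: le_trans (_ : (N * n) ^+ 2 * ((W * (n * N) * G) * (p * (V * (n ^+ 5 / q)))) <= _).
  apply: ler_wpM2l; first exact: sqr_ge0.
  by apply: ler_pM => //; [exact: mulr_ge0 (ltW p0) E0 | rewrite ler_pM2l].
have -> : (N * n) ^+ 2 * (W * (n * N) * G * (p * (V * (n ^+ 5 / q)))) =
  (W * V) * (N ^+ 3 * n ^+ 3 * G * p * (n ^+ 5 / q)) by ring.
have -> : n ^+ 4 * ((c * P * (N * n)) ^+ 4 * (p / (N * q) * G)) =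
  (c ^+ 4 * P ^+ 4) * (N ^+ 3 * n ^+ 3 * G * p * (n ^+ 5 / q)).
  by field; rewrite !lt0r_neq0.
apply: ler_wpM2r.
  by rewrite !mulr_ge0 ?exprn_ge0 ?invr_ge0 //; exact: ltW.
apply: le_trans WV _; apply: ler_wpM2r; first by rewrite exprn_ge0.
by apply: ler_eXnr.
Qed.

Lemma sixth_moment_bound : W * V <= c * P ^+ 6 -> E <= V * n ^+ 4 ->
  (n * S) ^+ 6 <= (N * n) ^+ 4 * (J * (p * E)) ->
  S ^+ 6 <= (c * P * (N * n)) ^+ 6 * (p / (N * n ^+ 3) * G).
Proof.
move=> WV hE h; have n6 : 0 < n ^+ 6 by rewrite exprn_gt0.
have Nn0 : 0 <= n * N by rewrite mulr_ge0 ?ltW.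
rewrite -(ler_pM2l n6) -exprMn; apply: le_trans h _.
apply: le_trans (_ : (N * n) ^+ 4 * ((W * (n * N) * G) * (p * (V * n ^+ 4))) <= _).
  apply: ler_wpM2l; first by rewrite exprn_ge0 // mulr_ge0 ?ltW.
  by apply: ler_pM => //; [exact: mulr_ge0 (ltW p0) E0 | rewrite ler_pM2l].
have -> : (N * n) ^+ 4 * (W * (n * N) * G * (p * (V * n ^+ 4))) =
  (W * V) * (N ^+ 5 * n ^+ 9 * G * p) by ring.
have -> : n ^+ 6 * ((c * P * (N * n)) ^+ 6 * (p / (N * n ^+ 3) * G)) =
  (c ^+ 6 * P ^+ 6) * (N ^+ 5 * n ^+ 9 * G * p).
  by field; rewrite !lt0r_neq0.
apply: ler_wpM2r.
  by rewrite !mulr_ge0 ?exprn_ge0 //; exact: ltW.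
apply: le_trans WV _; apply: ler_wpM2r; first by rewrite exprn_ge0.
by apply: ler_eXnr.
Qed.
End MomentsToBound.

Theorem theorem3p2 (R : realType) (eps : R) (heps : 0 < eps) :
  exists2 c : R, 0 < c &
    forall (p : nat) (H : {group {unit 'F_p}}) (L : int) (N : nat) (a : int),
      prime p ->
      (#|H|%:R : R) < p%:R `^ (1 / 2) ->
      (1 <= N <= p)%N ->
      coprimez a p%:Z ->
      \sum_(n <- int_interval L N) subgroup_sum R H (a * n)
        <= c * p%:R `^ eps * (N%:R * #|H|%:R)
           * Num.min (Delta1 R p N #|H| `^ (1 / 4))
                     (Delta2 R p N #|H| `^ (1 / 6)).
Proof.
have [C C0 hC] := energy_bounds R.
(* W V contains three logarithms and two divisor bounds, each at most a constant times p^(1/k). With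
   1/k <= eps/2 they cost p^(5 eps / 2), less than the p^(4 eps) or p^(6 eps) available before
   taking roots. *)
pose k := Num.bound (eps / 2)^-1.
have kb : (eps / 2)^-1 < k%:R by apply: archi_boundP; rewrite invr_ge0 divr_ge0 ?ler0n ?ltW.
have kR : 0 < k%:R :> R by apply: le_lt_trans kb; rewrite invr_ge0 divr_ge0 ?ler0n ?ltW.
have k0 : (0 < k)%N by rewrite -(ltr0n R).
have kd : k%:R^-1 <= eps / 2.
  by rewrite -[leRHS]invrK lef_pV2 ?posrE ?invr_gt0 ?divr_gt0 ?ltr0n // ltW.
have [Cd Cd0 hCd] := divisors_bound k.
(* 64 comes from the collisions, C from the energies, k^k from each of the three logarithms, 4 Cd
   from each of the two divisor bounds. *)
pose c := (64 * C * (k ^ k) ^ 3 * (4 * Cd) ^ 2)%N.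
have c0 : (0 < c)%N by rewrite /c !(muln_gt0, expn_gt0) k0 C0 Cd0.
exists c%:R; first by rewrite ltr0n.
move=> p H L N a pp Hp /andP[N0 Np] ap.
have p0 := prime_gt0 pp; have n0 : (0 < #|H|)%N := cardG_gt0 H.
have hG := card_unity_roots_subgroup H.
have hS := interval_sumE R L N a pp n0.
move: #|H| hG n0 Hp hS => n hG n0 Hp hS.
have nn : (n * n < p)%N.
  rewrite -(ltr_nat R) natrM -expr2 -[ltRHS]powRr1 ?ler0n //.
  rewrite -[X in _ `^ X](mulfVK (_ : 2%:R != 0)) ?pnatr_eq0 // powRrM powR_mulrn ?powR_ge0 //.
  by rewrite ltr_pXn2r ?nnegrE ?powR_ge0 ?ler0n.
have [D [D0 Dk hD]] := max_divisors_bound hCd p0.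
set l := (trunc_log 2 p).+1.
have lk : (l ^ k <= k ^ k * p)%N.
  apply: leq_trans (succ_exp_bound k _) _; rewrite leq_mul2l; apply/orP; right.
  exact: trunc_logP.
have kk0 : (0 < k ^ k)%N by rewrite expn_gt0 k0.
have C40 : (0 < 4 * Cd)%N by rewrite muln_gt0.
have lR := le_natr_powR k0 kk0 p0 lk kd.
have dR := le_natr_powR k0 C40 p0 Dk kd.
have [hE2 hE3] := hC p n pp n0 nn hG.
have hJ := collisions_Gamma R L pp n0 hG N0 D0 hD.
have aF : a%:~R != 0 :> 'F_p.
  rewrite (intr_pchar_eq0 _ (pchar_Fp pp)); apply/negP => pa.
  move: ap; rewrite /coprimez /gcdz /= => /eqP [] g1.
  have : (p %| gcdn `|a| p)%N by rewrite dvdn_gcd pa dvdnn.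
  by rewrite g1 dvdn1 => /eqP p1; move: pp; rewrite p1.
set Z := finset.setX [set: 'I_N] (unity_roots 'F_p n) in hS hJ.
have cZ : #|Z|%:R = N%:R * n%:R :> R by rewrite cardsX cardsT card_ord hG natrM.
pose f (z : 'I_N * 'F_p) : 'F_p := (L + (z.1 : nat).+1%:Z)%:~R * z.2.
have A0 := @gauss_norm_ge0 R p n.
have M4 := fourth_moment Z (fun z => a%:~R * f z) A0.
have M6 := sixth_moment Z (fun z => a%:~R * f z) A0.
rewrite -hS cZ coll_mulf // sum_gauss_norm4 // in M4.
rewrite -hS cZ coll_mulf // sum_gauss_norm6 // in M6.
have S0 : 0 <= \sum_(m <- int_interval L N) subgroup_sum R H (a * m).
  by apply: sumr_ge0 => m _; rewrite subgroup_sumE ?gauss_norm_ge0.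
move: (\sum_(m <- _) _) S0 M4 M6 => S S0 M4 M6.
have NR : 0 < N%:R :> R by rewrite ltr0n.
have nR : 0 < n%:R :> R by rewrite ltr0n.
have pR : 0 < p%:R :> R by rewrite ltr0n.
have G0 : 0 <= Gamma R p N n.
  by rewrite /Gamma !addr_ge0 ?divr_ge0 ?mulr_ge0 ?powR_ge0 ?ler0n.
have c1 : 1 <= c%:R :> R by rewrite ler1n.
have P0 : 0 <= p%:R `^ eps :> R by exact: powR_ge0.
have T0 : 0 <= c%:R * p%:R `^ eps * (N%:R * n%:R) by rewrite !mulr_ge0 ?ler0n.
pose W : R := 64 * l%:R ^+ 2 * D%:R ^+ 2.
pose V : R := C%:R * l%:R.
have WV j : (4 <= j)%N -> W * V <= c%:R * (p%:R `^ eps) ^+ j.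
  move=> j4; apply: le_trans (_ : 64 * C%:R * ((k ^ k)%N%:R * p%:R `^ (eps / 2)) ^+ 3 *
      ((4 * Cd)%N%:R * p%:R `^ (eps / 2)) ^+ 2 <= _).
    have -> : W * V = 64 * C%:R * l%:R ^+ 3 * D%:R ^+ 2 by rewrite /W /V; ring.
    apply: ler_pM; rewrite ?mulr_ge0 ?exprn_ge0 ?ler0n //.
      apply: ler_wpM2l; first by rewrite mulr_ge0 ?ler0n.
      by apply: lerXn2r lR; rewrite nnegrE ?mulr_ge0 ?powR_ge0 ?ler0n.
    by apply: lerXn2r dR; rewrite nnegrE ?mulr_ge0 ?powR_ge0 ?ler0n.
  have -> : 64 * C%:R * ((k ^ k)%N%:R * p%:R `^ (eps / 2)) ^+ 3 *
      ((4 * Cd)%N%:R * p%:R `^ (eps / 2)) ^+ 2 = c%:R * (p%:R `^ (eps / 2)) ^+ 5 :> R.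
    rewrite /c; move: (k ^ k)%N (4 * Cd)%N (_ `^ _) => K C4 x; rewrite 3!natrM !natrX; ring.
  apply: ler_wpM2l; rewrite ?ler0n // -!powR_mulrn ?powR_ge0 // -!powRrM.
  apply: ler_powR; first by rewrite ler1n.
  have : 4 <= j%:R :> R by rewrite ler_nat.
  nra.
have n49 : n%:R `^ (49 / 20) = n%:R ^+ 5 / n%:R `^ (2 + 11 / 20) :> R.
  apply: (canRL (mulfK _)); first by rewrite lt0r_neq0 ?powR_gt0.
  rewrite -powRD ?lt0r_neq0 ?implybT // -[RHS]powR_mulrn ?ler0n //; congr (_ `^ _); lra.
rewrite n49 in hE2.
have B4 := fourth_moment_bound NR nR pR (powR_gt0 _ nR) (ler0n _ _) (ler0n _ _) G0 c1 P0 hJ (WV 4%N isT) hE2 M4.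
have B6 := sixth_moment_bound NR nR pR (ler0n _ _) (ler0n _ _) G0 c1 P0 hJ (WV 6%N isT) hE3 M6.
have D1 : 0 <= Delta1 R p N n by rewrite /Delta1 mulr_ge0 // divr_ge0 ?mulr_ge0 ?powR_ge0 ?ler0n.
have D2 : 0 <= Delta2 R p N n by rewrite /Delta2 mulr_ge0 // divr_ge0 ?mulr_ge0 ?exprn_ge0 ?ler0n.
have F4 := le_mul_powR (isT : (0 < 4)%N) S0 T0 D1 B4.
have F6 := le_mul_powR (isT : (0 < 6)%N) S0 T0 D2 B6.
rewrite /Num.min; case: ifP => _; [exact: F4|exact: F6].
Qed.
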